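(* Consider the Gaussian three-node full-duplex network without side-channel described in the context, and let $C^{\rm No\text{-}SC}_{\rm sum}$ be its sum-capacity. Define \[ g=\begin{cases} C(\mathrm{SNR}_2)+C\!\left(\frac{\mathrm{SNR}_1}{1+\mathrm{INR}}\right), & \mathrm{INR}\le \mathrm{SNR}_2,\\[2pt] C(\mathrm{SNR}_1+\mathrm{INR}), & \mathrm{SNR}_2\le \mathrm{INR}\le \mathrm{SNR}_2(1+\mathrm{SNR}_1),\\[2pt] C(\mathrm{SNR}_1)+C(\mathrm{SNR}_2), & \mathrm{INR}\ge \mathrm{SNR}_2(1+\mathrm{SNR}_1).\end{cases} \] Then, as $\mathrm{SNR}_1,\mathrm{SNR}_2,\mathrm{INR}\to\infty$ with their ratios kept constant, the sum-capacity is asymptotically $g$, i.e. $C^{\rm No\text{-}SC}_{\rm sum}/g\to 1$.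
   Context: Gaussian three-node full-duplex network without side-channel: a full-duplex base station (BS) sends a downlink message $S_1$ at rate $R_1$ to a half-duplex mobile M2, while a half-duplex mobile M1 sends an uplink message $S_2$ at rate $R_2$ to BS. Real-valued channel: $Y_1=\gamma_1X_1+\gamma^m_{21}X_2+Z_1$ (received by M2), $Y_2=\gamma_2X_2+Z_2$ (received by BS; self-interference fully suppressed), $X_1$ sent by BS, $X_2$ sent by M1, $Z_1,Z_2$ independent i.i.d. $\mathcal N(0,\sigma^2)$, power constraints $\mathbb E|X_1|^2\le P_1$, $\mathbb E|X_2|^2\le P_2$. $\mathrm{SNR}_1=|\gamma_1|^2P_1/\sigma^2$, $\mathrm{SNR}_2=|\gamma_2|^2P_2/\sigma^2$, $\mathrm{INR}=|\gamma^m_{21}|^2P_2/\sigma^2$. $C(x)=W_m\log_2(1+x)$ where $W_m$ is the channel bandwidth. M2 decodes $S_1$ from $Y_1^n$; BS decodes $S_2$ from $Y_2^n$ and $S_1$; BS's transmitted symbol at time $i$ may be a function of $(S_1,Y_2^{i-1})$ (causal cognitive Z-interference channel). The sum-capacity is the supremum of $R_1+R_2$ over achievable rate pairs. *)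

(* Defs.v *)
From HB Require Import structures.
From mathcomp Require Import all_boot all_order all_algebra.
From mathcomp Require Import all_classical all_reals all_analysis.
From mathcomp Require Import normal_distribution.

Set Implicit Arguments.
Unset Strict Implicit.
Unset Printing Implicit Defensive.

Import Order.TTheory GRing.Theory Num.Theory.
Import numFieldNormedType.Exports.

Local Open Scope classical_set_scope.
Local Open Scope ring_scope.

Section FDNetwork.
Variable R : realType.

(* Iterated integral of a function of n i.i.d. N(0, s^2) real samples
   (s is the standard deviation): E[f(Z_0,...,Z_{n-1})]. *)
Fixpoint gauss_int (s : R) (n : nat) : (n.-tuple R -> \bar R) -> \bar R :=
  match n return (n.-tuple R -> \bar R) -> \bar R with
  | 0 => fun f => f [tuple]
  | k.+1 => fun f =>
      (\int[normal_prob 0 s]_(z in [set: R]) gauss_int s (fun t => f (cons_tuple z t)))%E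
  end.

(* A block code of length n with M1 downlink messages (S1, BS -> M2) and
   M2 uplink messages (S2, M1 -> BS). *)
Record fd_code (n M1 M2 : nat) := FDCode {
  (* mobile M1 (half-duplex): X2^n = enc2 S2 *)
  enc2 : 'I_M2 -> n.-tuple R;
  (* BS: X1_i = enc1 S1 i Y2^n, required (below) to depend only on Y2^{i-1} *)
  enc1 : 'I_M1 -> 'I_n -> n.-tuple R -> R;
  (* M2 decodes S1 from Y1^n *)
  dec1 : n.-tuple R -> 'I_M1;
  (* BS decodes S2 from (S1, Y2^n) *)
  dec2 : 'I_M1 -> n.-tuple R -> 'I_M2 }.

Definition fd_code_valid n M1 M2 (c : fd_code n M1 M2) : Prop :=
  [/\
      (forall s1 (i : 'I_n) (y y' : n.-tuple R),
         (forall j : 'I_n, (j < i)%N -> tnth y j = tnth y' j) ->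
         enc1 c s1 i y = enc1 c s1 i y'),
      (forall s1 i, measurable_fun [set: n.-tuple R] (enc1 c s1 i)),
      (forall m, measurable (dec1 c @^-1` [set m])) &
      (forall s1 m, measurable (dec2 c s1 @^-1` [set m]))].

Section Signals.
Variables (g1 g2 g21 : R) (n M1 M2 : nat) (c : fd_code n M1 M2).

Definition sig_x2 (s2 : 'I_M2) : n.-tuple R := enc2 c s2.
(* Y2 = g2 X2 + Z2 (self-interference fully suppressed) *)
Definition sig_y2 (s2 : 'I_M2) (z2 : n.-tuple R) : n.-tuple R :=
  [tuple g2 * tnth (sig_x2 s2) i + tnth z2 i | i < n].
Definition sig_x1 (s1 : 'I_M1) (s2 : 'I_M2) (z2 : n.-tuple R) : n.-tuple R :=
  [tuple enc1 c s1 i (sig_y2 s2 z2) | i < n].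
Definition sig_y1 s1 s2 (z1 z2 : n.-tuple R) : n.-tuple R :=
  [tuple g1 * tnth (sig_x1 s1 s2 z2) i + g21 * tnth (sig_x2 s2) i + tnth z1 i
  | i < n].

Definition fd_expect (sigma : R)
    (F : 'I_M1 -> 'I_M2 -> n.-tuple R -> n.-tuple R -> R) : \bar R :=
  (((M1 * M2)%:R)^-1)%:E *
  \sum_(s1 < M1) \sum_(s2 < M2)
     gauss_int sigma (fun z1 => gauss_int sigma (fun z2 => (F s1 s2 z1 z2)%:E)).

Definition fd_perr sigma : \bar R :=
  fd_expect sigma (fun s1 s2 z1 z2 =>
    ((dec1 c (sig_y1 s1 s2 z1 z2) != s1) || (dec2 c s1 (sig_y2 s2 z2) != s2))%:R).

Definition fd_pow1 sigma : \bar R :=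
  fd_expect sigma (fun s1 s2 z1 z2 =>
    n%:R^-1 * \sum_(i < n) tnth (sig_x1 s1 s2 z2) i ^+ 2).
Definition fd_pow2 sigma : \bar R :=
  fd_expect sigma (fun s1 s2 z1 z2 =>
    n%:R^-1 * \sum_(i < n) tnth (sig_x2 s2) i ^+ 2).
End Signals.

(* (R1, R2) in bits/s is achievable for the real channel of bandwidth W
   (2W real channel uses per second): for every eps > 0 and all large n
   there is a valid length-n code with at least 2^(n R_k/(2W)) messages,
   meeting the power constraints, with average error probability <= eps. *)
Definition fd_achievable (W sigma g1 g2 g21 P1 P2 R1 R2 : R) : Prop :=
  forall eps : R, 0 < eps -> exists N : nat, forall n : nat, (N <= n)%N ->
    exists M1 M2 : nat, exists c : fd_code n M1 M2,
      fd_code_valid c /\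
      [/\ (2 : R) `^ (n%:R * R1 / (2 * W)) <= M1%:R,
          (2 : R) `^ (n%:R * R2 / (2 * W)) <= M2%:R,
          (fd_pow1 g2 c sigma <= P1%:E)%E,
          (fd_pow2 c sigma <= P2%:E)%E &
          (fd_perr g1 g2 g21 c sigma <= eps%:E)%E].

Definition fd_sumcap (W sigma g1 g2 g21 P1 P2 : R) : R :=
  sup [set r | exists R1 R2, [/\ 0 <= R1, 0 <= R2,
                 fd_achievable W sigma g1 g2 g21 P1 P2 R1 R2 & r = R1 + R2]].

Definition capC (W x : R) : R := W * (ln (1 + x) / ln 2).

Definition g_approx (W snr1 snr2 inr : R) : R :=
  if inr <= snr2 then capC W snr2 + capC W (snr1 / (1 + inr))
  else if inr <= snr2 * (1 + snr1) then capC W (snr1 + inr)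
  else capC W snr1 + capC W snr2.

End FDNetwork.

(* Main.v *)
(* With fixed ratios every regime of [g] that occurs for large [t] equals
   [W log2 t + O(1)], so it suffices to trap the sum-capacity between
   [W log2 (c t)] and [W log2 (c' t)].

   Achievability: the uplink alone is enough. Words over a uniform alphabet of
   about sqrt(SNR2) levels are chosen greedily so that the sum of pairwise
   Bhattacharyya coefficients is at most its random-coding average; the union
   bound for nearest-neighbour decoding then gives error 2^-n.

   Converse: on correctly decoded noise sequences the joint density of the
   outputs is compared with the product of a fixed Gaussian density of [y1] and
   a Gaussian density of [y2] around (g2 / g21) (y1 - g1 x1), which depends on
   [s1] and past outputs but not on [s2], because the contribution of [x2]
   cancels. Integrating, the disjoint decoding regions of [s2] and then of [s1]
   collapse, so M1 M2 is at most the n-th power of a constant times sqrt(t).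
   The power constraints enter through the weight exp(-|x1|^2/P1 - |x2|^2/P2). *)

Require Import Defs.
From HB Require Import structures.
From mathcomp Require Import all_boot all_order all_algebra.
From mathcomp Require Import all_classical all_reals all_analysis.
From mathcomp Require Import measurable_realfun normal_distribution.
From mathcomp Require Import ring lra.

Set Implicit Arguments.
Unset Strict Implicit.
Unset Printing Implicit Defensive.

Import Order.TTheory GRing.Theory Num.Theory.
Import numFieldNormedType.Exports.
Local Open Scope classical_set_scope.
Local Open Scope ring_scope.

(** * Iterated integrals over tuples *)

Lemma measurable_comp2 d d1 d2 d3 (T : measurableType d) (T1 : measurableType d1)
    (T2 : measurableType d2) (U : measurableType d3)
    (f : T1 -> T2 -> U) (g : T -> T1) (h : T -> T2) :
  measurable_fun [set: T1 * T2] (fun p : T1 * T2 => f p.1 p.2) ->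
  measurable_fun [set: T] g -> measurable_fun [set: T] h ->
  measurable_fun [set: T] (fun x => f (g x) (h x)).
Proof.
move=> mf mg mh.
by apply: (measurableT_comp mf (g := fun x => (g x, h x))); apply/measurable_fun_pairP.
Qed.

Section tuple_integral.
Context {R : realType}.
Implicit Types (mu : {sigma_finite_measure set (measurableTypeR R) -> \bar R}).

(** The recursion of [gauss_int] over an arbitrary sigma-finite measure, so that Tonelli-type facts
    are proved once and serve both the Gaussian noise and Lebesgue measure on the outputs. *)
Fixpoint tint mu (n : nat) : (n.-tuple R -> \bar R) -> \bar R :=
  match n return (n.-tuple R -> \bar R) -> \bar R with
  | 0 => fun f => f [tuple]
  | k.+1 => fun f =>
      (\int[mu]_(z in [set: R]) tint mu (fun t => f (cons_tuple z t)))%E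
  end.

Lemma gauss_intE s n (f : n.-tuple R -> \bar R) :
  gauss_int s f = tint (normal_prob 0 s) f.
Proof. by elim: n f => //= n IH f; apply: eq_integral => z _; apply: IH. Qed.

Lemma eq_tint mu n (f g : n.-tuple R -> \bar R) :
  f =1 g -> tint mu f = tint mu g.
Proof. by move=> /funext ->. Qed.

Lemma tint_ge0 mu n (f : n.-tuple R -> \bar R) :
  (forall t, 0 <= f t)%E -> (0 <= tint mu f)%E.
Proof. by elim: n f => //= n IH f f0; apply: integral_ge0 => z _; apply: IH. Qed.

Lemma measurable_consT n (f : n.+1.-tuple R -> \bar R) :
  measurable_fun [set: n.+1.-tuple R] f ->
  measurable_fun [set: R * n.-tuple R]
    (fun p : R * n.-tuple R => f (cons_tuple p.1 p.2)).
Proof. by move=> mf; apply: (measurableT_comp mf); exact: measurable_cons. Qed.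

Lemma measurable_cons1 n (f : n.+1.-tuple R -> \bar R) (z : R) :
  measurable_fun [set: n.+1.-tuple R] f ->
  measurable_fun [set: n.-tuple R] (fun t => f (cons_tuple z t)).
Proof.
by move=> mf; apply: (measurableT_comp mf); apply: measurable_cons.
Qed.

(** The parameter space [T] is general because the induction enlarges it: the outermost integration
    variable is first treated as a parameter in [T * R], then integrated out by Tonelli. *)
Lemma measurable_tint mu n d (T : measurableType d)
    (f : T -> n.-tuple R -> \bar R) :
  (forall x t, 0 <= f x t)%E ->
  measurable_fun [set: T * n.-tuple R] (fun p : T * n.-tuple R => f p.1 p.2) ->
  measurable_fun [set: T] (fun x => tint mu (f x)).
Proof.
elim: n d T f => [|n IH] d T f f0 mf /=.
  exact: (measurableT_comp mf (pair2_measurable _)).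
apply: (@measurable_fun_fubini_tonelli_F _ _ _ _ _ mu
  (fun p : T * measurableTypeR R => tint mu (fun t => f p.1 (cons_tuple p.2 t)))).
  apply: (IH _ (T * measurableTypeR R)%type
     (fun p t => f p.1 (cons_tuple p.2 t))); first by [].
  apply: (measurable_comp2 mf) => //=.
    exact: measurableT_comp.
  by apply: measurable_cons => //=; apply: measurableT_comp.
by move=> p; apply: tint_ge0.
Qed.

Lemma measurable_tint_cons mu n (f : n.+1.-tuple R -> \bar R) :
  (forall t, 0 <= f t)%E ->
  measurable_fun [set: n.+1.-tuple R] f ->
  measurable_fun [set: measurableTypeR R]
    (fun z => tint mu (fun t => f (cons_tuple z t))).
Proof.
move=> f0 mf.
by apply: (measurable_tint mu (T := measurableTypeR R)) => //; exact: measurable_consT.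
Qed.

Lemma le_tint mu n (f g : n.-tuple R -> \bar R) :
  (forall t, 0 <= f t)%E ->
  measurable_fun [set: n.-tuple R] f -> measurable_fun [set: n.-tuple R] g ->
  (forall t, f t <= g t)%E -> (tint mu f <= tint mu g)%E.
Proof.
elim: n f g => [|n IH] f g f0 mf mg fg //=.
have g0 t : (0 <= g t)%E by apply: le_trans (fg t).
apply: ge0_le_integral => //=.
- by move=> z _; apply: tint_ge0.
- exact: measurable_tint_cons.
- exact: measurable_tint_cons.
- by move=> z _; apply: IH => //; exact: measurable_cons1.
Qed.

Lemma tintD mu n (f g : n.-tuple R -> \bar R) :
  (forall t, 0 <= f t)%E -> (forall t, 0 <= g t)%E ->
  measurable_fun [set: n.-tuple R] f -> measurable_fun [set: n.-tuple R] g ->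
  (tint mu (fun t => f t + g t) = tint mu f + tint mu g)%E.
Proof.
elim: n f g => [|n IH] f g f0 g0 mf mg //=.
rewrite -ge0_integralD//=.
- by apply: eq_integral => z _; apply: IH => //; exact: measurable_cons1.
- by move=> z _; apply: tint_ge0.
- exact: measurable_tint_cons.
- by move=> z _; apply: tint_ge0.
- exact: measurable_tint_cons.
Qed.

Lemma tintZl mu n (k : R) (f : n.-tuple R -> \bar R) : 0 <= k ->
  (forall t, 0 <= f t)%E -> measurable_fun [set: n.-tuple R] f ->
  (tint mu (fun t => k%:E * f t) = k%:E * tint mu f)%E.
Proof.
move=> k0; elim: n f => [|n IH] f f0 mf //=.
rewrite -ge0_integralZl_EFin//=.
- by apply: eq_integral => z _; apply: IH => //; exact: measurable_cons1.
- by move=> z _; apply: tint_ge0.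
- exact: measurable_tint_cons.
Qed.

Lemma tint0 mu n : tint mu (fun _ : n.-tuple R => 0%E) = 0%E.
Proof. by elim: n => //= n ->; exact: integral0. Qed.

Lemma tint_sum mu n (I : Type) (s : seq I) (f : I -> n.-tuple R -> \bar R) :
  (forall i t, 0 <= f i t)%E ->
  (forall i, measurable_fun [set: n.-tuple R] (f i)) ->
  (tint mu (fun t => \sum_(i <- s) f i t) = \sum_(i <- s) tint mu (f i))%E.
Proof.
move=> f0 mf; elim: s => [|i s IH].
  by rewrite big_nil -[RHS](tint0 mu n); apply: eq_tint => t; rewrite big_nil.
rewrite big_cons -IH -tintD//.
- by apply: eq_tint => t; rewrite big_cons.
- by move=> t; apply: sume_ge0.
- exact: emeasurable_sum.
Qed.

Lemma tint_swap1 mu n (f : R -> n.-tuple R -> \bar R) :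
  (forall x t, 0 <= f x t)%E ->
  measurable_fun [set: R * n.-tuple R] (fun p : R * n.-tuple R => f p.1 p.2) ->
  (\int[mu]_x tint mu (f x) = tint mu (fun t => \int[mu]_x f x t))%E.
Proof.
elim: n f => [|n IH] f f0 mf //=.
have mf' : measurable_fun [set: (measurableTypeR R * measurableTypeR R) * n.-tuple R]
    (fun p : (R * R) * n.-tuple R => f p.1.1 (cons_tuple p.1.2 p.2)).
  apply: (measurable_comp2 mf) => //=.
    exact: measurableT_comp.
  by apply: measurable_cons => //=; apply: measurableT_comp.
rewrite (@fubini_tonelli _ _ _ _ _ mu mu
  (fun p : R * R => tint mu (fun t => f p.1 (cons_tuple p.2 t)))) /=; first last.
- by move=> p; apply: tint_ge0.
- exact: (measurable_tint mu (T := (measurableTypeR R * measurableTypeR R)%type)).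
apply: eq_integral => z _; apply: IH => //.
apply: (measurable_comp2 mf) => //=.
by apply: measurable_cons.
Qed.

(** The coordinates of the first block are carried one at a time past the whole second block by
    [tint_swap1]. *)
Lemma tint_swap mu n m (f : n.-tuple R -> m.-tuple R -> \bar R) :
  (forall x t, 0 <= f x t)%E ->
  measurable_fun [set: n.-tuple R * m.-tuple R]
    (fun p : n.-tuple R * m.-tuple R => f p.1 p.2) ->
  (tint mu (fun x => tint mu (f x)) = tint mu (fun t => tint mu (f ^~ t)))%E.
Proof.
elim: n f => [|n IH] f f0 mf //=.
under eq_integral.
  move=> z _; rewrite IH//; last first.
    apply: (measurable_comp2 mf) => //=.
    by apply: measurable_cons.
  over.
rewrite tint_swap1//.
  by move=> x t; apply: tint_ge0.
apply: (measurable_tint mu (T := (R * m.-tuple R)%type)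
   (f := fun p t => f (cons_tuple p.1 t) p.2)) => //.
apply: (measurable_comp2 mf) => //=.
  by apply: measurable_cons => //=; apply: measurableT_comp.
exact: measurableT_comp.
Qed.

End tuple_integral.

(** * Gaussian expectations as Lebesgue integrals, and translation invariance *)

Section density.
Import HBNNSimple.
Context {R : realType}.
Local Notation leb := (@lebesgue_measure R).

(** By uniqueness of Lebesgue measure: its image under the translation gives each interval []x, y]]
    its length. *)
Lemma ge0_integral_shift (a : R) (f : R -> \bar R) :
  (forall x, 0 <= f x)%E -> measurable_fun [set: R] f ->
  (\int[leb]_x f (a + x)%R = \int[leb]_x f x)%E.
Proof.
move=> f0 mf.
have ms : measurable_fun [set: R] (fun x : R => a + x).
  exact: measurable_funD.
pose h (x : measurableTypeR R) : measurableTypeR R := a + x.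
transitivity (\int[pushforward leb h]_x f x)%E.
  by rewrite ge0_integral_pushforward.
apply: eq_measure_integral => //= A mA _; apply/esym.
apply: (lebesgue_measure_unique (mu := pushforward leb h)) => // _ [[x y]] _ <- /=.
rewrite /pushforward.
have -> : (fun x : R => a + x) @^-1` `]x, y]%classic = `]x - a, y - a]%classic.
  by apply/seteqP; split => z /=; rewrite !in_itv/= ltrBlDl lerBrDl.
by rewrite !lebesgue_measure_itv/= !lte_fin ltrD2r -!EFinD opprB addrA subrK.
Qed.

(** Simple functions come first, by linearity from indicators; monotone convergence along an
    increasing simple approximation gives the rest. *)
Lemma ge0_integral_normal_prob (m s : R) (f : R -> \bar R) :
  (forall x, 0 <= f x)%E -> measurable_fun [set: R] f ->
  (\int[normal_prob m s]_x f x = \int[leb]_x (f x * (normal_pdf m s x)%:E))%E.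
Proof.
move=> f0 mf.
have mpdf : measurable_fun [set: measurableTypeR R] (EFin \o normal_pdf m s).
  by apply/measurable_EFinP; exact: measurable_normal_pdf.
have p0 x : 0 <= normal_pdf m s x by exact: normal_pdf_ge0.
have simple (g : {nnsfun (measurableTypeR R) >-> R}) :
    (\int[normal_prob m s]_x (g x)%:E =
     \int[leb]_x ((g x)%:E * (normal_pdf m s x)%:E))%E.
  rewrite integralT_nnsfun sintegralE.
  under [RHS]eq_integral.
    move=> x _; rewrite fimfunE -fsumEFin// ge0_mule_fsuml; last first.
      by move=> r; exact: nnfun_muleindic_ge0.
    over.
  rewrite [RHS]ge0_integral_fsum//; last 2 first.
  - move=> r; apply: emeasurable_funM => //.
    by apply/measurable_EFinP; apply: measurable_funM.
  - by move=> r x _; rewrite mule_ge0 ?lee_fin//; exact: nnfun_muleindic_ge0.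
  apply: eq_fsbigr => r _.
  (* A nonnegative function never takes a value [r < 0], so both sides vanish there. *)
  have [r0|r0] := leP 0 r; last first.
    rewrite preimage_nnfun0// measure0 mule0.
    by under eq_integral do rewrite indic0 /= mulr0 mul0e; rewrite integral0.
  rewrite /normal_prob -ge0_integralZl//=.
  - rewrite [LHS]integral_mkcond; apply: eq_integral => x _.
    rewrite patchE indicE; case: ifPn => _ /=; first by rewrite mulr1.
    by rewrite mulr0 mul0e.
  - exact: measurable_funTS.
  - by move=> x _; rewrite lee_fin.
have mf1 : measurable_fun [set: measurableTypeR R] f := mf.
pose g := nnsfun_approx measurableT mf1.
transitivity (lim (\int[normal_prob m s]_x (g n x)%:E @[n --> \oo])%E).
  rewrite -monotone_convergence//=.
  - apply: eq_integral => ? _; apply/esym/cvg_lim => //=.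
    exact: cvg_nnsfun_approx.
  - move=> n; exact/measurable_EFinP.
  - by move=> n ? _; rewrite lee_fin.
  - by move=> ? _ ? ? mn; rewrite lee_fin; exact/lefP/nd_nnsfun_approx.
under eq_fun do rewrite simple.
rewrite -monotone_convergence//=.
- apply: eq_integral => x _; apply/cvg_lim => //.
  by apply: cvgeZr => //; exact: cvg_nnsfun_approx.
- move=> n; apply: emeasurable_funM => //.
  exact/measurable_EFinP/measurable_funTS.
- by move=> n x _; rewrite mule_ge0 ?lee_fin.
- move=> x _ i j ij; rewrite lee_wpmul2r ?lee_fin//.
  exact/lefP/nd_nnsfun_approx.
Qed.

Lemma gauss_int_lebesgue s n (f : n.-tuple R -> \bar R) :
  (forall t, 0 <= f t)%E -> measurable_fun [set: n.-tuple R] f ->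
  gauss_int s f =
  tint leb (fun t => (f t * (\prod_(i < n) normal_pdf 0 s (tnth t i))%:E)%E).
Proof.
elim: n f => [|n IH] f f0 mf /=; first by rewrite big_ord0 mule1.
rewrite ge0_integral_normal_prob; first last.
- under eq_fun do rewrite gauss_intE; exact: measurable_tint_cons.
- by move=> x; rewrite gauss_intE; exact: tint_ge0.
apply: eq_integral => z _.
have mc := measurable_cons1 z mf.
rewrite IH// muleC -tintZl//; first last.
- apply: emeasurable_funM => //; apply/measurable_EFinP.
  apply: measurable_prod => i _.
  apply: measurableT_comp; first exact: measurable_normal_pdf.
  exact: measurable_tnth.
- move=> t; rewrite mule_ge0// lee_fin; apply: prodr_ge0 => i _.
  exact: normal_pdf_ge0.
- exact: normal_pdf_ge0.
apply: eq_tint => t; rewrite big_ord_recl /= EFinM muleCA; congr (_ * (_ * _))%E.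
by congr (_ %:E); apply: eq_bigr => i _; rewrite tnthS.
Qed.

Lemma tint_shift n (a : 'I_n -> R) (f : n.-tuple R -> \bar R) :
  (forall t, 0 <= f t)%E -> measurable_fun [set: n.-tuple R] f ->
  tint leb (fun t => f [tuple a i + tnth t i | i < n]) = tint leb f.
Proof.
elim: n a f => [|n IH] a f f0 mf /=; first by rewrite [[tuple _ | _ < _]]tuple0.
rewrite -[RHS](@ge0_integral_shift (a ord0)); first last.
- exact: measurable_tint_cons.
- by move=> x; apply: tint_ge0.
apply: eq_integral => z _.
have mc := measurable_cons1 (a ord0 + z) mf.
rewrite -(IH (fun i => a (lift ord0 i)) _ _ mc)//.
apply: eq_tint => t; congr f; apply: eq_from_tnth => i.
rewrite tnth_mktuple; case: (unliftP ord0 i) => [j ->|->]; last by rewrite !tnth0.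
by rewrite !tnthS tnth_mktuple.
Qed.

End density.

(** * Integrals of products with causal dependence *)

Section causal_product.
Context {R : realType}.
Variable mu : {sigma_finite_measure set (measurableTypeR R) -> \bar R}.

(* The last coordinate is integrated innermost, so each factor may depend on
   the previous coordinates without changing the value of the integral. *)
Lemma tint_prod_causal n (f : 'I_n -> R -> n.-tuple R -> R) (k : 'I_n -> R) (c : R) :
  0 <= c -> (forall i y t, 0 <= f i y t) -> (forall i, 0 <= k i) ->
  (forall (i : 'I_n) y (t t' : n.-tuple R), (forall j : 'I_n, (j < i)%N -> tnth t j = tnth t' j) ->
    f i y t = f i y t') ->
  (forall i t, measurable_fun [set: R] (f i ^~ t)) ->
  (forall i t, \int[mu]_y (f i y t)%:E = (k i)%:E)%E ->
  (tint mu (fun t => (c * \prod_(i < n) f i (tnth t i) t)%:E) =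
   (c * \prod_(i < n) k i)%:E)%E.
Proof.
elim: n f k c => [|n IH] f k c c0 f0 k0 fcaus mf fk /=; first by rewrite !big_ord0.
(* No coordinate precedes [ord0], so the first factor takes the same value at any tuple, here the
   zero tuple. Freed of the tail, it is absorbed into the constant [c] of the induction
   hypothesis. *)
pose t0 : n.+1.-tuple R := [tuple 0 | _ < n.+1].
have fz z t : f ord0 z (cons_tuple z t) = f ord0 z t0 by exact: fcaus.
under eq_integral.
  move=> z _.
  rewrite (@eq_tint _ mu _ _ (fun t => ((c * f ord0 z t0) * \prod_(i < n)
    f (lift ord0 i) (tnth t i) (cons_tuple z t))%:E)%E); last first.
    move=> t; rewrite big_ord_recl tnth0 fz mulrA; congr (_ * _)%:E.
    by apply: eq_bigr => i _; rewrite tnthS.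
  rewrite (IH (fun i y t => f (lift ord0 i) y (cons_tuple z t))
    (fun i => k (lift ord0 i)))//; first last.
  - by move=> i y t t' tt'; apply: fcaus => j; case: (unliftP ord0 j) => [j' ->|->] //;
      rewrite ?tnth0// !tnthS => ji; apply: tt'.
  - by rewrite mulr_ge0.
  rewrite mulrAC EFinM.
  over.
rewrite ge0_integralZl//.
- by rewrite fk -EFinM big_ord_recl -mulrA [X in _ = (c * X)%:E]mulrC.
- by apply/measurable_EFinP; exact: mf.
- by move=> z _; rewrite lee_fin.
- by rewrite lee_fin mulr_ge0// prodr_ge0.
Qed.

End causal_product.

(** * Gaussian error bounds and codes *)

Section gaussian.
Context {R : realType}.
Local Notation leb := (@lebesgue_measure R).

Lemma integral_gaussian (m v : R) : 0 < v ->
  (\int[leb]_y (expR (- (y - m) ^+ 2 / v))%:E = (Num.sqrt (pi * v))%:E)%E.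
Proof.
(* The standard deviation with [2 s^2 = v]: the integrand is then the normal density divided by its
   peak. *)
move=> v0; pose s := Num.sqrt (v / 2).
have s2 : s ^+ 2 = v / 2 by rewrite sqr_sqrtr// ltW// divr_gt0.
have s0 : s != 0 by rewrite gt_eqF// sqrtr_gt0 divr_gt0.
have pk : (normal_peak s)^-1 = Num.sqrt (pi * v).
  by rewrite /normal_peak invrK s2; congr Num.sqrt; field.
have pk0 : 0 < Num.sqrt (pi * v) by rewrite sqrtr_gt0 mulr_gt0// pi_gt0.
transitivity ((Num.sqrt (pi * v))%:E * \int[leb]_x (normal_pdf m s x)%:E)%E; last first.
  by rewrite integral_normal_pdf mule1.
rewrite -ge0_integralZl.
- apply: eq_integral => y _; rewrite normal_pdfE// -EFinM mulrA -pk.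
  rewrite mulVf ?gt_eqF ?normal_peak_gt0// mul1r /normal_fun s2.
  by congr (expR (_ / _))%:E; field.
- exact: measurableT.
- by apply/measurable_EFinP; exact: measurable_normal_pdf.
- by move=> y _; rewrite lee_fin normal_pdf_ge0.
- by rewrite lee_fin ltW.
Qed.

Lemma measurable_natr_bool d (T : measurableType d) (b : T -> bool) :
  measurable_fun [set: T] b -> measurable_fun [set: T] (fun x => (b x)%:R : R).
Proof.
move=> mb; rewrite (_ : (fun x => _) = fun x => if b x then 1 else 0 : R).
  exact: measurable_fun_ifT.
by apply/funext => x; case: (b x).
Qed.

(* The integrand is the square root of the likelihood ratio of the means [-d]
   and [0]; its mean is the Bhattacharyya coefficient. *)
Lemma integral_bhattacharyya (s d : R) : s != 0 ->
  (\int[normal_prob 0 s]_z (expR (- (2 * z * d + d ^+ 2) / (4 * s ^+ 2)))%:E =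
   (expR (- d ^+ 2 / (8 * s ^+ 2)))%:E)%E.
Proof.
move=> s0.
have me : measurable_fun [set: R]
    (fun z : R => (expR (- (2 * z * d + d ^+ 2) / (4 * s ^+ 2)))%:E).
  apply/measurable_EFinP; apply: measurableT_comp => //.
  apply: measurable_funM => //; apply: measurableT_comp => //.
  by apply: measurable_funD => //; apply: measurable_funM => //; exact: measurable_funM.
rewrite ge0_integral_normal_prob//.
(* Completing the square turns the integrand times the centred density into a constant times the
   density of mean [- d / 2]. *)
transitivity ((expR (- d ^+ 2 / (8 * s ^+ 2)))%:E *
    \int[leb]_x (normal_pdf (- (d / 2)) s x)%:E)%E; last first.
  by rewrite integral_normal_pdf mule1.
rewrite -ge0_integralZl.
- apply: eq_integral => z _; rewrite !normal_pdfE// -!EFinM; congr (_%:E).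
  rewrite mulrCA [RHS]mulrCA; congr (_ * _).
  rewrite /normal_fun -!expRD; congr expR; field; exact: s0.
- exact: measurableT.
- by apply/measurable_EFinP; exact: measurable_normal_pdf.
- by move=> z _; rewrite lee_fin normal_pdf_ge0.
- by rewrite lee_fin expR_ge0.
Qed.

Lemma gauss_int_cst (s : R) n (c : \bar R) :
  gauss_int s (fun _ : n.-tuple R => c) = c.
Proof.
elim: n => //= n IH; under eq_integral do rewrite IH.
by rewrite integral_cst// [X in (_ * X)%E](@probability_setT _ _ _ (normal_prob 0 s)) mule1.
Qed.

(** Chernoff bound with exponent 1/2: the indicator is at most the square root of the likelihood
    ratio, a product over coordinates whose mean is a product of Bhattacharyya coefficients. *)
Lemma gauss_int_pairwise_error (s : R) n (d : 'I_n -> R) : s != 0 ->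
  (gauss_int s (fun z : n.-tuple R =>
     (\sum_(i < n) (tnth z i + d i) ^+ 2 <= \sum_(i < n) tnth z i ^+ 2)%R%:R%:E) <=
   (\prod_(i < n) expR (- d i ^+ 2 / (8 * s ^+ 2)))%:E)%E.
Proof.
move=> s0; rewrite gauss_intE.
pose f (i : 'I_n) (z : R) (_ : n.-tuple R) :=
  expR (- (2 * z * d i + d i ^+ 2) / (4 * s ^+ 2)).
have mf i : measurable_fun [set: R] (fun z : R => 2 * z * d i + d i ^+ 2).
  by apply: measurable_funD => //; apply: measurable_funM => //; exact: measurable_funM.
have mt i : measurable_fun [set: n.-tuple R] (fun t : n.-tuple R => tnth t i).
  exact: measurable_tnth.
have mfe i : measurable_fun [set: R]
    (fun z : R => expR (- (2 * z * d i + d i ^+ 2) / (4 * s ^+ 2))).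
  apply: measurableT_comp => //; apply: measurable_funM => //.
  exact: measurableT_comp.
rewrite -[X in (_ <= X%:E)%E]mul1r.
rewrite -(@tint_prod_causal _ (normal_prob 0 s) n f _ _ ler01 (fun i y t => expR_ge0 _)
  (fun i => expR_ge0 _) (fun _ _ _ _ _ => erefl) (fun i _ => mfe i)
  (fun i t => integral_bhattacharyya (d i) s0)).
apply: le_tint.
- by move=> t; rewrite lee_fin.
- apply/measurable_EFinP; apply: measurable_natr_bool; apply: measurable_fun_ler.
    by apply: measurable_sum => i; apply: measurable_funX; apply: measurable_funD.
  by apply: measurable_sum => i; apply: measurable_funX.
- apply/measurable_EFinP; apply: measurable_funM => //.
  by apply: measurable_prod => i _; apply: (measurableT_comp (mfe i)).
move=> t; rewrite lee_fin mul1r.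
have -> : \prod_(i < n) f i (tnth t i) t =
    expR ((\sum_(i < n) tnth t i ^+ 2 - \sum_(i < n) (tnth t i + d i) ^+ 2)
          / (4 * s ^+ 2)).
  rewrite -expR_sum -sumrB mulr_suml; congr expR.
  by apply: eq_bigr => i _; congr (_ / _); ring.
have [le|_] := leP (\sum_(i < n) (tnth t i + d i) ^+ 2) (\sum_(i < n) tnth t i ^+ 2);
  last exact: expR_ge0.
rewrite -expR0 ler_expR divr_ge0 ?subr_ge0//.
by rewrite mulr_ge0// sqr_ge0.
Qed.

Lemma measurable_sig_y2 (g2 : R) n M1 M2 (c : fd_code R n M1 M2) s2 :
  measurable_fun [set: n.-tuple R] (sig_y2 g2 c s2).
Proof.
apply/measurable_fun_tnthP => i.
rewrite (_ : _ \o _ = fun z : n.-tuple R => g2 * tnth (sig_x2 c s2) i + tnth z i).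
  by apply: measurable_funD => //; exact: measurable_tnth.
by apply/funext => z; rewrite /= tnth_mktuple.
Qed.

End gaussian.

(** * Nearest-neighbour decoding *)

Section nearest_neighbour.
Context {R : realType}.

Definition sqdist n (u y : n.-tuple R) : R := \sum_(i < n) (tnth y i - tnth u i) ^+ 2.

(** A word wins only when strictly nearer than all others, which makes the winner unique and its
    region a finite intersection of strict inequalities; ties go to [s0]. *)
Definition nearest n M (s0 : 'I_M) (c : 'I_M -> n.-tuple R) (y : n.-tuple R) : 'I_M :=
  odflt s0 [pick s | [forall s', (s' != s) ==> (sqdist (c s) y < sqdist (c s') y)]].

Lemma measurable_sqdist n (u : n.-tuple R) :
  measurable_fun [set: n.-tuple R] (sqdist u).
Proof.
apply: measurable_sum => i; apply: measurable_funX; apply: measurable_funB => //.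
exact: measurable_tnth.
Qed.

Lemma measurable_nearest n M (s0 : 'I_M) (c : 'I_M -> n.-tuple R) (m : 'I_M) :
  measurable (nearest s0 c @^-1` [set m]).
Proof.
pose P s := [set y | [forall s', (s' != s) ==> (sqdist (c s) y < sqdist (c s') y)]].
have mP s : measurable (P s).
  have -> : P s = \bigcap_(s' in [set s' | s' != s])
      (fun y => sqdist (c s) y < sqdist (c s') y) @^-1` [set true].
    apply/seteqP; split => y /=.
      by move=> /forallP h s' /= ss'; have /implyP := h s'; exact.
    by move=> h; apply/forallP => s'; apply/implyP => ss'; exact: h.
  apply: fin_bigcap_measurable; first exact: finite_finset.
  move=> s' _; rewrite -[X in measurable X]setTI.
  by apply: measurable_fun_ltr => //; exact: measurable_sqdist.
have uP s s' y : P s y -> P s' y -> s = s'.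
  move=> /forallP/(_ s') h /forallP/(_ s) h'; apply/eqP; apply: contraT => ss'.
  have {}h := implyP h; rewrite eq_sym ss' in h; have {}h := h isT.
have {}h' := implyP h' ss'.
  by have := lt_trans h h'; rewrite ltxx.
(* The region of [m] is where it wins outright; the default [s0] also receives the points without a
   winner. *)
have -> : nearest s0 c @^-1` [set m] =
    P m `|` (if m == s0 then ~` (\bigcup_(s in [set: 'I_M]) P s) else set0).
  apply/seteqP; split => y /=; rewrite /nearest; case: pickP => /= [s Ps|nP].
  - by move=> <-; left.
  - by move=> <-; right; rewrite eqxx => -[s _ Ps]; have := nP s; rewrite Ps.
  - case=> [Pm|]; first exact: (uP _ _ y).
    by case: ifP => // _ [] //; exists s.
  - by case=> [Pm|]; [have := nP m; rewrite Pm|case: ifP => // /eqP].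
apply: measurableU => //; case: ifP => // _; apply: measurableC.
by apply: fin_bigcup_measurable => //; exact: finite_finset.
Qed.

(** Union bound: a wrong output, whether a rival wins or a tie is resolved by default, forces some
    other word to be at least as near as [c s]. *)
Lemma nearest_error n M (s0 : 'I_M) (c : 'I_M -> n.-tuple R) (s : 'I_M) y :
  (nearest s0 c y != s)%:R <=
  \sum_(s' | s' != s) (sqdist (c s') y <= sqdist (c s) y)%R%:R :> R.
Proof.
have [_|ns] := eqVneq (nearest s0 c y) s; first by rewrite sumr_ge0.
suff [s' ss' h] : exists2 s', s' != s & sqdist (c s') y <= sqdist (c s) y.
  by rewrite (bigD1 s')//= h lerDl sumr_ge0.
move: ns; rewrite /nearest; case: pickP => /= [s1 /forallP /(_ s) h s1s|h _].
  by exists s1 => //; move: h; rewrite eq_sym s1s /= => /ltW.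
have /negbT := h s; rewrite negb_forall => /existsP[s']; rewrite negb_imply.
by move=> /andP[ss']; rewrite -leNgt => le; exists s'.
Qed.

End nearest_neighbour.

(** * Greedy selection of words with small total pairwise weight *)

Section greedy.
Context {R : realFieldType}.

(** With truncated subtraction the exponent is [|u - v|]. The correction [2^-u] strengthens the
    claim for induction: shifting both indices leaves only the term [v = 0], of value [2^-(u + 1)],
    which the correction pays for exactly. *)
Lemma sum_half_dist (u q : nat) :
  \sum_(v < q) (2^-1 : R) ^+ ((u - v) + (v - u)) <= 3 - 2^-1 ^+ u.
Proof.
have h0 k : 0 <= (2^-1 : R) ^+ k by apply: exprn_ge0; rewrite invr_ge0.
have h1 k : (2^-1 : R) ^+ k <= 1 by apply: exprn_ile1; lra.
elim: u q => [|u IH] q.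
  have -> : \sum_(v < q) (2^-1 : R) ^+ ((0 - v) + (v - 0)) = 2 - 2 * 2^-1 ^+ q.
    elim: q => [|q IH]; first by rewrite big_ord0 expr0; ring.
    by rewrite big_ord_recr/= IH sub0n subn0 add0n exprS; field.
  by rewrite expr0; have := h0 q; lra.
case: q => [|q].
  by rewrite big_ord0; have := h1 u.+1; lra.
rewrite big_ord_recl/= subn0 sub0n addn0.
under eq_bigr do rewrite /bump/= add1n !subSS.
by have := IH q; rewrite exprS; have := h0 u; lra.
Qed.

Variables (q : nat) (w : 'I_q -> 'I_q -> R) (C : R).
Hypotheses (q0 : (0 < q)%N) (w0 : forall u v, 0 <= w u v)
  (wC : forall u v, w u v = w v u) (wle : forall u, \sum_v w u v <= C).

(** First-moment argument: summed over all [q^n] words, each product factorizes by coordinates into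
    at most [C^n], so not every word can exceed the average. *)
Lemma greedy_step n M (c : 'I_M -> {ffun 'I_n -> 'I_q}) :
  exists v : {ffun 'I_n -> 'I_q},
    \sum_(j < M) \prod_(i < n) w (c j i) (v i) <= M%:R * (C / q%:R) ^+ n.
Proof.
apply: contrapT => /forallNP h.
have q0' : 0 < q%:R :> R by rewrite ltr0n.
have C0 : 0 <= C by apply: le_trans (wle (Ordinal q0)); exact: sumr_ge0.
have : \sum_(v : {ffun 'I_n -> 'I_q}) \sum_(j < M) \prod_(i < n) w (c j i) (v i)
    <= M%:R * C ^+ n.
  rewrite exchange_big/= -[M in M%:R](card_ord M) -sum1_card natr_sum mulr_suml.
  apply: ler_sum => j _; rewrite mul1r -(bigA_distr_bigA (fun i v => w (c j i) v)).
  rewrite -[n in C ^+ n](card_ord n) -prodr_const.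
  by apply: ler_prod => i _; rewrite sumr_ge0/=.
apply/negP; rewrite -ltNge.
have -> : M%:R * C ^+ n =
    \sum_(v : {ffun 'I_n -> 'I_q}) M%:R * (C / q%:R) ^+ n.
  rewrite sumr_const card_ffun !card_ord -[RHS]mulr_natr natrX -mulrA -exprMn.
  by rewrite divfK// gt_eqF.
apply: ltr_sum; last by move=> v _; rewrite ltNge; apply/negP.
apply/hasP; exists [ffun=> Ordinal q0] => //; exact: mem_index_enum.
Qed.

(* Each codeword is chosen so that its total weight to the earlier ones does
   not exceed the average over all words. *)
Lemma greedy_code n M : exists c : 'I_M -> {ffun 'I_n -> 'I_q},
  \sum_(j < M) \sum_(k < M | k != j) \prod_(i < n) w (c j i) (c k i)
  <= (M ^ 2)%:R * (C / q%:R) ^+ n.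
Proof.
have e0 : 0 <= (C / q%:R) ^+ n.
  apply: exprn_ge0; apply: divr_ge0 => //.
  by apply: le_trans (wle (Ordinal q0)); exact: sumr_ge0.
elim: M => [|M [c IH]]; first by exists (fun=> [ffun=> Ordinal q0]); rewrite big_ord0 mul0r.
have [v hv] := greedy_step c.
pose c' (j : 'I_M.+1) := if unlift ord0 j is Some j' then c j' else v.
exists c'.
have c0 : c' ord0 = v by rewrite /c' unlift_none.
have cS j : c' (lift ord0 j) = c j by rewrite /c' liftK.
rewrite big_ord_recl.
have -> : \sum_(k < M.+1 | k != ord0) \prod_(i < n) w (c' ord0 i) (c' k i) =
    \sum_(j < M) \prod_(i < n) w (c j i) (v i).
  rewrite big_mkcond big_ord_recl/= add0r; apply: eq_bigr => j _.
  by rewrite c0 cS; apply: eq_bigr => i _.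
have -> : \sum_(j < M) \sum_(k < M.+1 | k != lift ord0 j)
      \prod_(i < n) w (c' (lift ord0 j) i) (c' k i) =
    \sum_(j < M) (\prod_(i < n) w (c j i) (v i) +
      \sum_(k < M | k != j) \prod_(i < n) w (c j i) (c k i)).
  apply: eq_bigr => j _; rewrite big_mkcond big_ord_recl/= c0 cS; congr (_ + _).
  by rewrite [RHS]big_mkcond; apply: eq_bigr => k _; rewrite (inj_eq lift_inj) cS.
rewrite big_split/=.
(* By symmetry of [w] the new word contributes its total weight to the old ones twice, which the
   term [2 M] of [(M + 1)^2] covers. *)
have : (M.+1 ^ 2)%:R * (C / q%:R) ^+ n = (M ^ 2)%:R * (C / q%:R) ^+ n +
   2 * (M%:R * (C / q%:R) ^+ n) + (C / q%:R) ^+ n :> R.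
  by rewrite -addn1 !natrX natrD; ring.
by lra.
Qed.

End greedy.

(** * Uplink code over equally spaced amplitudes *)

Section achievability.
Context {R : realType}.

Lemma expRN_nat_le (k : nat) : expR (- k%:R ^+ 2) <= (2^-1 : R) ^+ k.
Proof.
have le2 : expR (-1) <= (2^-1 : R).
  by rewrite expRN lef_pV2 ?posrE ?expR_gt0//; have := expR_ge1Dx (1 : R); lra.
apply: (@le_trans _ _ (expR (- k%:R))).
  by rewrite ler_expR lerN2 -natrX ler_nat; case: k => // k; rewrite -[leqLHS]muln1 leq_pmul2l.
rewrite -mulN1r expRM_natr.
by apply: lerXn2r; rewrite ?nnegrE ?expR_ge0 ?invr_ge0.
Qed.

Lemma natr_sub_sqr (u v : nat) :
  (u%:R - v%:R) ^+ 2 = (((u - v) + (v - u))%N%:R : R) ^+ 2.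
Proof.
have [uv|/ltnW vu] := leqP u v.
  by rewrite (eqP (_ : u - v == 0)%N) ?subn_eq0// add0n natrB//; ring.
by rewrite (eqP (_ : v - u == 0)%N) ?subn_eq0// addn0 natrB.
Qed.

Lemma exists_expr_half (eps : R) : 0 < eps ->
  exists N : nat, forall n, (N <= n)%N -> (2^-1 : R) ^+ n <= eps.
Proof.
move=> e0; exists (Num.truncn eps^-1).+1 => n Nn.
rewrite -[leRHS]invrK exprVn lef_pV2 ?posrE ?invr_gt0 ?exprn_gt0//.
apply: le_trans (ltW (truncnS_gt _)) _.
rewrite -natrX ler_nat; apply: leq_trans Nn _.
exact/ltnW/ltn_expl.
Qed.

Variables (sigma g1 g2 g21 P2 : R) (m : nat).
Hypotheses (sigma0 : 0 < sigma) (P20 : 0 < P2) (m0 : (0 < m)%N).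
Hypothesis snr_ge : 8 * (8 * m%:R) ^+ 2 * sigma ^+ 2 <= g2 ^+ 2 * P2.

(** The alphabet is 8 times larger than the [m] messages per symbol: a factor 4 pays for the row
    sums of [w], and the remaining 2 leaves the error [m^n (4 / (8 m))^n = 2^-n]. *)
Let q := (8 * m)%N.
Let step : R := Num.sqrt P2 / q%:R.
Let w (u v : 'I_q) : R :=
  expR (- (g2 * (step * (u%:R - v%:R))) ^+ 2 / (8 * sigma ^+ 2)).

Let q0 : 0 < q%:R :> R. Proof. by rewrite ltr0n muln_gt0. Qed.

(** At this spacing [w u v <= exp(-(u - v)^2)], so the row sums of [w] stay bounded whatever the
    number of levels. *)
Let step2 : 8 * sigma ^+ 2 <= (g2 * step) ^+ 2.
Proof.
have -> : (g2 * step) ^+ 2 = g2 ^+ 2 * P2 / q%:R ^+ 2.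
  by rewrite /step exprMn expr_div_n sqr_sqrtr ?(ltW P20)// mulrA.
rewrite ler_pdivlMr ?exprn_gt0//.
apply: le_trans snr_ge; rewrite /q natrM.
by rewrite mulrAC.
Qed.

Let w_le u v : w u v <= 2^-1 ^+ ((u - v) + (v - u)).
Proof.
apply: le_trans (expRN_nat_le _).
rewrite ler_expR mulNr lerN2 -natr_sub_sqr.
rewrite mulrA exprMn mulrAC ler_peMl ?sqr_ge0//.
by rewrite ler_pdivlMr ?mul1r// mulr_gt0// exprn_gt0.
Qed.

Let wC u v : w u v = w v u.
Proof. by rewrite /w -[u%:R - v%:R]opprB !mulrN sqrrN. Qed.

Let w_sum u : \sum_v w u v <= 4.
Proof.
apply: (le_trans (ler_sum _ (fun v _ => w_le u v))).
apply: le_trans (sum_half_dist _ _) _.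
have : 0 <= (2^-1 : R) ^+ u by apply: exprn_ge0; rewrite invr_ge0.
by lra.
Qed.

Let word n (x : {ffun 'I_n -> 'I_q}) : n.-tuple R :=
  [tuple step * (x i)%:R | i < n].

Let word_le n (x : {ffun 'I_n -> 'I_q}) i : tnth (word x) i ^+ 2 <= P2.
Proof.
rewrite tnth_mktuple /step exprMn expr_div_n sqr_sqrtr ?(ltW P20)//.
rewrite -mulrA ler_piMr ?(ltW P20)// mulrC ler_pdivrMr ?exprn_gt0// mul1r.
by apply: lerXn2r; rewrite ?nnegrE ?ler0n// ler_nat ltnW.
Qed.

Section code.
Variables (n : nat) (n0 : (0 < n)%N).
Let M := (m ^ n)%N.
Let M0 : (0 < M)%N. Proof. by rewrite expn_gt0 m0. Qed.
Variable x : 'I_M -> {ffun 'I_n -> 'I_q}.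
Let rx s : n.-tuple R := [tuple g2 * tnth (word (x s)) i | i < n].

(** One downlink message and a silent BS: the downlink has rate 0, costs no power and cannot be
    decoded wrongly. *)
Let code : fd_code R n 1 M :=
  FDCode (fun s => word (x s)) (fun _ _ _ => 0) (fun _ => ord0)
         (fun _ => nearest (Ordinal M0) rx).

Lemma pam_code_valid : fd_code_valid code.
Proof.
split => //=.
- move=> k; rewrite (_ : _ @^-1` _ = setT)//.
  by apply/seteqP; split => // y _ /=; rewrite !ord1.
- by move=> _ k; exact: measurable_nearest.
Qed.

Lemma pam_code_pow1 : fd_pow1 g2 code sigma = 0%E.
Proof.
rewrite /fd_pow1 /fd_expect big1 ?mule0// => s1 _; rewrite big1// => s2 _.
rewrite (_ : (fun _ => _) = fun=> 0%E) ?gauss_int_cst//.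
apply/funext => z1; rewrite (_ : (fun _ => _) = fun=> 0%E) ?gauss_int_cst//.
apply/funext => z2; rewrite big1 ?mulr0// => i _.
by rewrite tnth_mktuple expr0n.
Qed.

Lemma pam_code_pow2 : (fd_pow2 code sigma <= P2%:E)%E.
Proof.
have M0' : 0 < M%:R :> R by rewrite ltr0n.
rewrite /fd_pow2 /fd_expect mul1n big_ord1.
rewrite (eq_bigr (fun s => (n%:R^-1 * \sum_(i < n) tnth (word (x s)) i ^+ 2)%:E)).
  rewrite sumEFin -EFinM lee_fin mulrC ler_pdivrMr//.
  apply: (@le_trans _ _ (\sum_(s < M) P2)).
    apply: ler_sum => s _; rewrite mulrC ler_pdivrMr ?ltr0n//.
    apply: (@le_trans _ _ (\sum_(i < n) P2)); first by apply: ler_sum => i _; exact: word_le.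
    by rewrite sumr_const card_ord mulr_natr.
  by rewrite sumr_const card_ord mulr_natr.
by move=> s _; rewrite !gauss_int_cst.
Qed.

Lemma pam_code_perr :
  \sum_(j < M) \sum_(k < M | k != j) \prod_(i < n) w (x j i) (x k i)
    <= (M ^ 2)%:R * (4 / q%:R) ^+ n ->
  (fd_perr g1 g2 g21 code sigma <= ((2^-1 : R) ^+ n)%:E)%E.
Proof.
move=> hx; have M0' : 0 < M%:R :> R by rewrite ltr0n.
rewrite /fd_perr /fd_expect mul1n big_ord1.
apply: (@le_trans _ _ (M%:R^-1%:E * \sum_(s < M)
    (\sum_(k < M | k != s) \prod_(i < n) w (x s i) (x k i))%:E)%E); last first.
  rewrite sumEFin -EFinM lee_fin mulrC ler_pdivrMr//.
  rewrite (le_trans hx)// natrX expr2 -mulrA mulrC.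
  rewrite (_ : M%:R * (4 / q%:R) ^+ n = 2^-1 ^+ n)//.
  rewrite /M natrX -exprMn natrM; congr (_ ^+ _); field.
  by rewrite pnatr_eq0 -lt0n.
apply: lee_wpmul2l; first by rewrite lee_fin invr_ge0.
apply: lee_sum => s _.
rewrite /= gauss_int_cst.
have mden := measurable_sig_y2 g2 code s.
have msq u : measurable_fun [set: n.-tuple R] (fun z => sqdist u (sig_y2 g2 code s z)).
  by apply: (measurableT_comp (measurable_sqdist u)).
apply: (@le_trans _ _ (gauss_int sigma (fun z => (\sum_(k < M | k != s)
    (sqdist (rx k) (sig_y2 g2 code s z) <= sqdist (rx s) (sig_y2 g2 code s z))%R%:R)%:E))).
  rewrite !gauss_intE; apply: le_tint.
  - by move=> t; rewrite lee_fin.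
  - apply/measurable_EFinP/measurable_natr_bool.
    apply: (measurable_fun_bool false); rewrite setTI.
    rewrite (_ : _ @^-1` _ = sig_y2 g2 code s @^-1` (nearest (Ordinal M0) rx @^-1` [set s])).
      rewrite -[X in measurable X]setTI; apply: mden => //.
      exact: measurable_nearest.
    by apply/seteqP; split => z /=; [move=> /negbFE/eqP|move=> ->; rewrite eqxx].
  - apply/measurable_EFinP; under eq_fun do rewrite big_mkcond.
    apply: measurable_sum => k; case: (k != s) => //.
    by apply: measurable_natr_bool; exact: measurable_fun_ler.
  - by move=> t; rewrite lee_fin; exact: nearest_error.
rewrite (_ : (fun _ => _) = fun z => (\sum_(k < M | k != s)
    (sqdist (rx k) (sig_y2 g2 code s z) <= sqdist (rx s) (sig_y2 g2 code s z))%R%:R%:E)%E);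
  last by apply/funext => z; rewrite sumEFin.
rewrite gauss_intE -big_filter; under eq_tint do rewrite -big_filter.
rewrite tint_sum; first last.
- by move=> k; apply/measurable_EFinP/measurable_natr_bool; exact: measurable_fun_ler.
- by move=> k t; rewrite lee_fin.
rewrite -sumEFin; apply: lee_sum => k _.
(* Received difference between the sent word [s] and its rival [k], so that [y2 - rx k = z2 + d]. *)
pose d i := g2 * (step * ((x s i)%:R - (x k i)%:R)).
apply: le_trans (_ : (_ <= (\prod_(i < n) expR (- d i ^+ 2 / (8 * sigma ^+ 2)))%:E)%E) _ => //.
apply: le_trans (gauss_int_pairwise_error d (lt0r_neq0 sigma0)).
rewrite gauss_intE le_eqVlt; apply/orP; left; apply/eqP; apply: eq_tint => z.
congr ((_ <= _)%R%:R%:E).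
  by apply: eq_bigr => i _; rewrite !tnth_mktuple /d; ring.
by apply: eq_bigr => i _; rewrite !tnth_mktuple; ring.
Qed.

End code.

Lemma pam_achievable (W P1 : R) : 0 < W -> 0 < P1 ->
  fd_achievable W sigma g1 g2 g21 P1 P2 0 (2 * W * (ln m%:R / ln 2)).
Proof.
move=> W0 P10 eps /exists_expr_half[N hN].
(* The successor ensures [n > 0], since the average power divides by [n]. *)
exists N.+1 => n Nn; have n0 : (0 < n)%N by exact: leq_trans Nn.
have ln20 : ln 2 != 0 :> R by rewrite gt_eqF// ln_gt0// ltr1n.
have q00 : (0 < q)%N by rewrite muln_gt0.
have [x hx] := greedy_code q00 (fun u v => expR_ge0 _) wC w_sum n (m ^ n).
exists 1%N, (m ^ n)%N; eexists; split; first exact: (pam_code_valid x).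
split.
- by rewrite mulr0 mul0r powRr0.
- rewrite natrX -powR_mulrn// /powR !pnatr_eq0 /= (gtn_eqF m0).
  rewrite (_ : n%:R * (2 * W * (ln m%:R / ln 2)) / (2 * W) * ln 2 = n%:R * ln m%:R)//.
  by field; rewrite ln20 gt_eqF.
- by rewrite pam_code_pow1 lee_fin ltW.
- exact: pam_code_pow2.
- by apply: le_trans (pam_code_perr hx) _; rewrite lee_fin; apply: hN; exact: ltnW.
Qed.

End achievability.

(** * Converse *)

Section converse.
Context {R : realType}.
Local Notation leb := (@lebesgue_measure R).

Lemma measurable_decision d (T : measurableType d) M (f : T -> 'I_M) (m : 'I_M) :
  measurable (f @^-1` [set m]) ->
  measurable_fun [set: T] (fun y => (f y == m)%:R : R).
Proof.
move=> mf; apply: measurable_natr_bool; apply: (measurable_fun_bool true).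
rewrite setTI (_ : _ @^-1` _ = f @^-1` [set m])//.
by apply/seteqP; split => y /= /eqP.
Qed.

(** Weighted Cauchy-Schwarz, with defect [(q u - p v)^2 / (p q (p + q))]. It distributes the
    exponent of a sum of signals over its terms. *)
Lemma sqr_divD_le (u v p q : R) : 0 < p -> 0 < q ->
  (u + v) ^+ 2 / (p + q) <= u ^+ 2 / p + v ^+ 2 / q.
Proof.
move=> p0 q0; rewrite ler_pdivrMr ?addr_gt0// -subr_ge0.
rewrite (_ : _ - _ = (q * u - p * v) ^+ 2 / (p * q)).
  by rewrite divr_ge0 ?sqr_ge0// mulr_ge0 ?ltW.
by field; rewrite !gt_eqF.
Qed.

(** * Monotonicity and linearity of double integrals and of [fd_expect] *)

Section double_integral.
Variables (n : nat) (mu : {sigma_finite_measure set (measurableTypeR R) -> \bar R}).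
Implicit Types F G : n.-tuple R -> n.-tuple R -> R.

Let dint F := tint mu (fun z1 => tint mu (fun z2 => (F z1 z2)%:E)).

Lemma measurable_tint2 F : (forall z1 z2, 0 <= F z1 z2) ->
  measurable_fun [set: n.-tuple R * n.-tuple R] (fun p => F p.1 p.2) ->
  measurable_fun [set: n.-tuple R] (fun z1 => tint mu (fun z2 => (F z1 z2)%:E)).
Proof.
move=> F0 mF; apply: (measurable_tint mu (f := fun z1 z2 => (F z1 z2)%:E)).
  by move=> z1 z2; rewrite lee_fin.
exact/measurable_EFinP.
Qed.

Lemma measurable_section F z1 :
  measurable_fun [set: n.-tuple R * n.-tuple R] (fun p => F p.1 p.2) ->
  measurable_fun [set: n.-tuple R] (fun z2 => (F z1 z2)%:E).
Proof.
by move=> mF; apply/measurable_EFinP; apply: (measurable_comp2 (f := F)).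
Qed.

Lemma le_dint F G : (forall z1 z2, 0 <= F z1 z2) ->
  measurable_fun [set: n.-tuple R * n.-tuple R] (fun p => F p.1 p.2) ->
  measurable_fun [set: n.-tuple R * n.-tuple R] (fun p => G p.1 p.2) ->
  (forall z1 z2, F z1 z2 <= G z1 z2) -> (dint F <= dint G)%E.
Proof.
move=> F0 mF mG FG.
have G0 z1 z2 : 0 <= G z1 z2 by apply: le_trans (FG z1 z2).
apply: le_tint.
- by move=> z1; apply: tint_ge0 => z2; rewrite lee_fin.
- exact: measurable_tint2.
- exact: measurable_tint2.
move=> z1; apply: le_tint.
- by move=> z2; rewrite lee_fin.
- exact: measurable_section.
- exact: measurable_section.
by move=> z2; rewrite lee_fin.
Qed.

Lemma dintD F G : (forall z1 z2, 0 <= F z1 z2) -> (forall z1 z2, 0 <= G z1 z2) ->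
  measurable_fun [set: n.-tuple R * n.-tuple R] (fun p => F p.1 p.2) ->
  measurable_fun [set: n.-tuple R * n.-tuple R] (fun p => G p.1 p.2) ->
  (dint (fun z1 z2 => F z1 z2 + G z1 z2)%R = dint F + dint G)%E.
Proof.
move=> F0 G0 mF mG; rewrite /dint -tintD.
- apply: eq_tint => z1; rewrite -tintD//; first last.
  + exact: measurable_section.
  + exact: measurable_section.
  + by move=> z2; rewrite lee_fin.
  + by move=> z2; rewrite lee_fin.
- by move=> z1; apply: tint_ge0 => z2; rewrite lee_fin.
- by move=> z1; apply: tint_ge0 => z2; rewrite lee_fin.
- exact: measurable_tint2.
- exact: measurable_tint2.
Qed.

Lemma dintZl k F : 0 <= k -> (forall z1 z2, 0 <= F z1 z2) ->
  measurable_fun [set: n.-tuple R * n.-tuple R] (fun p => F p.1 p.2) ->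
  (dint (fun z1 z2 => k * F z1 z2)%R = k%:E * dint F)%E.
Proof.
move=> k0 F0 mF; rewrite /dint -tintZl//.
- apply: eq_tint => z1; rewrite -tintZl//; first last.
  + exact: measurable_section.
  + by move=> z2; rewrite lee_fin.
- by move=> z1; apply: tint_ge0 => z2; rewrite lee_fin.
- exact: measurable_tint2.
Qed.

End double_integral.

Section expectation.
Variables (n M1 M2 : nat) (sigma : R).
Hypotheses (M10 : (0 < M1)%N) (M20 : (0 < M2)%N).
Implicit Types F G : 'I_M1 -> 'I_M2 -> n.-tuple R -> n.-tuple R -> R.

Let MM0 : 0 <= ((M1 * M2)%N%:R)^-1 :> R. Proof. by rewrite invr_ge0. Qed.

Definition measurable_family F := forall s1 s2,
  measurable_fun [set: n.-tuple R * n.-tuple R] (fun p => F s1 s2 p.1 p.2).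

Lemma gauss_int2E (f : n.-tuple R -> n.-tuple R -> R) :
  gauss_int sigma (fun z1 => gauss_int sigma (fun z2 => (f z1 z2)%:E)) =
  tint (normal_prob 0 sigma) (fun z1 => tint (normal_prob 0 sigma) (fun z2 => (f z1 z2)%:E)).
Proof. by rewrite gauss_intE; apply: eq_tint => z1; rewrite gauss_intE. Qed.

Lemma gauss_int2_ge0 (f : n.-tuple R -> n.-tuple R -> R) :
  (forall z1 z2, 0 <= f z1 z2) ->
  (0 <= gauss_int sigma (fun z1 => gauss_int sigma (fun z2 => (f z1 z2)%:E)))%E.
Proof.
move=> f0; rewrite gauss_int2E.
by apply: tint_ge0 => z1; apply: tint_ge0 => z2; rewrite lee_fin.
Qed.

Lemma le_fd_expect F G : (forall s1 s2 z1 z2, 0 <= F s1 s2 z1 z2) ->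
  measurable_family F -> measurable_family G ->
  (forall s1 s2 z1 z2, F s1 s2 z1 z2 <= G s1 s2 z1 z2) ->
  (fd_expect sigma F <= fd_expect sigma G)%E.
Proof.
move=> F0 mF mG FG; apply: lee_wpmul2l; first by rewrite lee_fin.
apply: lee_sum => s1 _; apply: lee_sum => s2 _; rewrite !gauss_int2E.
exact: le_dint.
Qed.

Lemma fd_expectD F G : (forall s1 s2 z1 z2, 0 <= F s1 s2 z1 z2) ->
  (forall s1 s2 z1 z2, 0 <= G s1 s2 z1 z2) ->
  measurable_family F -> measurable_family G ->
  (fd_expect sigma (fun s1 s2 z1 z2 => F s1 s2 z1 z2 + G s1 s2 z1 z2)%R =
   fd_expect sigma F + fd_expect sigma G)%E.
Proof.
move=> F0 G0 mF mG.
rewrite /fd_expect -ge0_muleDr; first last.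
- by apply: sume_ge0 => s1 _; apply: sume_ge0 => s2 _; exact: gauss_int2_ge0.
- by apply: sume_ge0 => s1 _; apply: sume_ge0 => s2 _; exact: gauss_int2_ge0.
congr (_ * _)%E; rewrite -big_split/=; apply: eq_bigr => s1 _.
rewrite -big_split/=; apply: eq_bigr => s2 _; rewrite !gauss_int2E.
exact: dintD.
Qed.

Lemma fd_expectZl k F : 0 <= k -> (forall s1 s2 z1 z2, 0 <= F s1 s2 z1 z2) ->
  measurable_family F ->
  (fd_expect sigma (fun s1 s2 z1 z2 => k * F s1 s2 z1 z2)%R = k%:E * fd_expect sigma F)%E.
Proof.
move=> k0 F0 mF; rewrite /fd_expect muleCA; congr (_ * _)%E.
have I0 s1 s2 := gauss_int2_ge0 (F0 s1 s2).
rewrite ge0_sume_distrr; last by move=> s1 _; apply: sume_ge0.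
apply: eq_bigr => s1 _; rewrite ge0_sume_distrr//.
apply: eq_bigr => s2 _; rewrite !gauss_int2E.
exact: dintZl.
Qed.

Lemma fd_expect_cst (k : R) :
  fd_expect (M1 := M1) (M2 := M2) sigma (fun _ _ (_ _ : n.-tuple R) => k) = k%:E.
Proof.
rewrite /fd_expect.
under eq_bigr do under eq_bigr do rewrite !gauss_int_cst.
rewrite !sumEFin -EFinM; congr (_%:E).
rewrite !sumr_const !card_ord -[_ *+ M2]mulr_natr -[_ *+ M1]mulr_natr -mulrA -natrM.
by rewrite (mulnC M2) mulrC mulfK// pnatr_eq0 -lt0n muln_gt0 M10.
Qed.

End expectation.
End converse.

(** * Bound on [M1 M2] for one fixed code *)

Section code_bound.
Context {R : realType}.
Local Notation leb := (@lebesgue_measure R).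
Variables (n M1 M2 : nat) (c : fd_code R n M1 M2) (sigma g1 g2 g21 P1 P2 : R).
Hypotheses (n0 : (0 < n)%N) (M10 : (0 < M1)%N) (M20 : (0 < M2)%N).
Hypotheses (sigma0 : 0 < sigma) (P10 : 0 < P1) (P20 : 0 < P2).
Hypotheses (g10 : g1 != 0) (g20 : g2 != 0) (g210 : g21 != 0).
Hypothesis cv : fd_code_valid c.

Let mtnth i : measurable_fun [set: n.-tuple R] (fun t : n.-tuple R => tnth t i).
Proof. exact: measurable_tnth. Qed.

Let my2 s2 : measurable_fun [set: n.-tuple R] (sig_y2 g2 c s2).
Proof. exact: measurable_sig_y2. Qed.

Let mx1 s1 s2 i :
  measurable_fun [set: n.-tuple R] (fun z => tnth (sig_x1 g2 c s1 s2 z) i).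
Proof.
under eq_fun do rewrite tnth_mktuple.
by case: cv => _ menc _ _; exact: (measurableT_comp (menc s1 i)).
Qed.

Let my1 s1 s2 : measurable_fun [set: n.-tuple R * n.-tuple R]
  (fun p => sig_y1 g1 g2 g21 c s1 s2 p.1 p.2).
Proof.
apply/measurable_fun_tnthP => i.
rewrite (_ : _ \o _ = fun p : n.-tuple R * n.-tuple R =>
    g1 * tnth (sig_x1 g2 c s1 s2 p.2) i + g21 * tnth (sig_x2 c s2) i + tnth p.1 i); last first.
  by apply/funext => z; rewrite /= tnth_mktuple.
apply: measurable_funD; last exact: (measurableT_comp (mtnth i)).
apply: measurable_funD => //; apply: measurable_funM => //.
exact: (measurableT_comp (mx1 s1 s2 i)).
Qed.

Let mdec1 s1 : measurable_fun [set: n.-tuple R] (fun y => (dec1 c y == s1)%:R : R).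
Proof. by case: cv => _ _ md _; exact: measurable_decision. Qed.

Let mdec2 s1 s2 : measurable_fun [set: n.-tuple R] (fun y => (dec2 c s1 y == s2)%:R : R).
Proof. by case: cv => _ _ _ md; exact: measurable_decision. Qed.

Let ok s1 s2 y1 y2 : R := (dec1 c y1 == s1)%:R * (dec2 c s1 y2 == s2)%:R.

Let pow1 s1 s2 (z2 : n.-tuple R) : R := \sum_(i < n) tnth (sig_x1 g2 c s1 s2 z2) i ^+ 2.
Let pow2 s2 : R := \sum_(i < n) tnth (sig_x2 c s2) i ^+ 2.
Let cost s1 s2 z2 : R := pow1 s1 s2 z2 / P1 + pow2 s2 / P2.

(** The factor [exp(- cost)] turns the average power constraint into a pointwise tool: it supplies
    the input terms of the exponent in [density_le]. *)
Let weight s1 s2 (z1 z2 : n.-tuple R) : R :=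
  ok s1 s2 (sig_y1 g1 g2 g21 c s1 s2 z1 z2) (sig_y2 g2 c s2 z2) * expR (- cost s1 s2 z2).

Let mok s1 s2 : measurable_fun [set: n.-tuple R * n.-tuple R]
  (fun p => ok s1 s2 (sig_y1 g1 g2 g21 c s1 s2 p.1 p.2) (sig_y2 g2 c s2 p.2)).
Proof.
apply: measurable_funM; first exact: (measurableT_comp (mdec1 s1)).
by apply: (measurableT_comp (mdec2 s1 s2)); exact: (measurableT_comp (my2 s2)).
Qed.

Let mpow1 s1 s2 : measurable_fun [set: n.-tuple R * n.-tuple R]
  (fun p => pow1 s1 s2 p.2).
Proof.
apply: measurable_sum => i; apply: measurable_funX.
exact: (measurableT_comp (mx1 s1 s2 i)).
Qed.

Let mweight : measurable_family weight.
Proof.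
move=> s1 s2; apply: measurable_funM; first exact: mok.
apply: measurableT_comp => //; apply: measurableT_comp => //.
apply: measurable_funD => //; exact: measurable_funM.
Qed.

Let pow1_ge0 s1 s2 z2 : 0 <= pow1 s1 s2 z2.
Proof. by apply: sumr_ge0 => i _; exact: sqr_ge0. Qed.

Let pow2_ge0 s2 : 0 <= pow2 s2.
Proof. by apply: sumr_ge0 => i _; exact: sqr_ge0. Qed.

Let ok_ge0 s1 s2 y1 y2 : 0 <= ok s1 s2 y1 y2.
Proof. by rewrite /ok mulr_ge0. Qed.

Let weight_ge0 s1 s2 z1 z2 : 0 <= weight s1 s2 z1 z2.
Proof. by rewrite mulr_ge0// expR_ge0. Qed.

(** Decoding fails with probability at most 1/4. The cost has mean at most [2 n], so by Markov it
    exceeds [4 n] with probability at most 1/2. On the remaining quarter the weight is at least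
    [exp(- 4 n)]. *)
Lemma weight_lower_bound :
  (fd_pow1 g2 c sigma <= P1%:E)%E -> (fd_pow2 c sigma <= P2%:E)%E ->
  (fd_perr g1 g2 g21 c sigma <= (4^-1)%:E)%E ->
  ((expR (- (4 * n%:R)) / 4)%:E <= fd_expect sigma weight)%E.
Proof.
move=> hp1 hp2 herr.
set C := expR (- (4 * n%:R)).
have C0 : 0 < C by exact: expR_gt0.
have n0' : 0 < n%:R :> R by rewrite ltr0n.
pose err s1 s2 z1 z2 : R :=
  ((dec1 c (sig_y1 g1 g2 g21 c s1 s2 z1 z2) != s1) || (dec2 c s1 (sig_y2 g2 c s2 z2) != s2))%:R.
pose f1 s1 s2 (z1 z2 : n.-tuple R) : R := n%:R^-1 * pow1 s1 s2 z2.
pose f2 (s1 : 'I_M1) s2 (z1 z2 : n.-tuple R) : R := n%:R^-1 * pow2 s2.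
have errE s1 s2 z1 z2 : err s1 s2 z1 z2 =
    1 - ok s1 s2 (sig_y1 g1 g2 g21 c s1 s2 z1 z2) (sig_y2 g2 c s2 z2).
  rewrite /err /ok; case: eqP => _; case: eqP => _ /=; ring.
have merr : measurable_family err.
  move=> s1 s2; under eq_fun do rewrite errE.
  by apply: measurable_funB => //; exact: mok.
have mf1 : measurable_family f1.
  by move=> s1 s2; apply: measurable_funM => //; exact: mpow1.
have mf2 : measurable_family f2 by move=> s1 s2; exact: measurable_cst.
have err0 s1 s2 z1 z2 : 0 <= err s1 s2 z1 z2 by rewrite /err.
have f10 s1 s2 z1 z2 : 0 <= f1 s1 s2 z1 z2 by rewrite mulr_ge0// invr_ge0 ltW.
have f20 s1 s2 z1 z2 : 0 <= f2 s1 s2 z1 z2 by rewrite mulr_ge0// invr_ge0 ltW.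
(* Each of the three terms has mean at most [C / 4], by the error bound and the two power
   constraints. *)
pose bad s1 s2 z1 z2 := C * err s1 s2 z1 z2 +
  (C / (4 * P1) * f1 s1 s2 z1 z2 + C / (4 * P2) * f2 s1 s2 z1 z2).
have k1 : 0 <= C / (4 * P1) by rewrite divr_ge0 ?mulr_ge0 ?ltW.
have k2 : 0 <= C / (4 * P2) by rewrite divr_ge0 ?mulr_ge0 ?ltW.
have mbad : measurable_family bad.
  move=> s1 s2; apply: measurable_funD; first by apply: measurable_funM => //; exact: merr.
  by apply: measurable_funD; apply: measurable_funM => //; exact: mf1.
have bad0 s1 s2 z1 z2 : 0 <= bad s1 s2 z1 z2.
  by rewrite /bad !addr_ge0// mulr_ge0// ltW.
(* Markov's inequality in pointwise form: either decoding fails, or the cost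
   exceeds its mean bound [2 n] twofold, or the weight is at least [C]. *)
have pointwise s1 s2 z1 z2 : C <= weight s1 s2 z1 z2 + bad s1 s2 z1 z2.
  have badE : bad s1 s2 z1 z2 = C * err s1 s2 z1 z2 + C * (cost s1 s2 z2 / (4 * n%:R)).
    rewrite /bad /f1 /f2 /cost; congr (_ + _); field.
    by rewrite !gt_eqF.
  have cost0 : 0 <= cost s1 s2 z2.
    by rewrite addr_ge0// divr_ge0// ltW.
  have Q0 : 0 <= C * (cost s1 s2 z2 / (4 * n%:R)).
    by rewrite mulr_ge0 ?(ltW C0)// divr_ge0// mulr_ge0// ltW.
  rewrite badE errE /weight.
  have [->|->] : ok s1 s2 (sig_y1 g1 g2 g21 c s1 s2 z1 z2) (sig_y2 g2 c s2 z2) = 0 \/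
     ok s1 s2 (sig_y1 g1 g2 g21 c s1 s2 z1 z2) (sig_y2 g2 c s2 z2) = 1.
  - rewrite /ok; case: eqP => _; case: eqP => _ /=; rewrite ?mulr1 ?mulr0; by [left|right].
  - by rewrite mul0r subr0 mulr1 add0r lerDl.
  rewrite subrr mulr0 add0r mul1r.
  have [small|/ltW large] := leP (cost s1 s2 z2) (4 * n%:R).
    by rewrite ler_wpDr// ler_expR lerN2.
  rewrite ler_wpDl ?expR_ge0// ler_peMr ?(ltW C0)//.
  by rewrite ler_pdivlMr ?mul1r// mulr_gt0.
have Ebad : (fd_expect sigma bad <= (3 * (C / 4))%:E)%E.
  have b10 s1 s2 z1 z2 : 0 <= C * err s1 s2 z1 z2 by rewrite mulr_ge0// ltW.
  have b20 s1 s2 z1 z2 : 0 <= C / (4 * P1) * f1 s1 s2 z1 z2 by rewrite mulr_ge0.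
  have b30 s1 s2 z1 z2 : 0 <= C / (4 * P2) * f2 s1 s2 z1 z2 by rewrite mulr_ge0.
  have mb1 : measurable_family (fun s1 s2 z1 z2 => C * err s1 s2 z1 z2).
    by move=> s1 s2; apply: measurable_funM => //; exact: merr.
  have mb2 : measurable_family (fun s1 s2 z1 z2 => C / (4 * P1) * f1 s1 s2 z1 z2).
    by move=> s1 s2; apply: measurable_funM => //; exact: mf1.
  have mb3 : measurable_family (fun s1 s2 z1 z2 => C / (4 * P2) * f2 s1 s2 z1 z2).
    by move=> s1 s2; apply: measurable_funM => //; exact: mf2.
  rewrite (fd_expectD sigma b10 (fun s1 s2 z1 z2 => addr_ge0 (b20 s1 s2 z1 z2) (b30 s1 s2 z1 z2))
     mb1 (fun s1 s2 => measurable_funD (mb2 s1 s2) (mb3 s1 s2))).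
  rewrite (fd_expectD sigma b20 b30 mb2 mb3).
  rewrite (fd_expectZl sigma (ltW C0) err0 merr) (fd_expectZl sigma k1 f10 mf1).
  rewrite (fd_expectZl sigma k2 f20 mf2).
  rewrite (_ : 3 * (C / 4) = C * 4^-1 + (C / (4 * P1) * P1 + C / (4 * P2) * P2)); last first.
    by field; rewrite !gt_eqF.
  rewrite 2!EFinD; apply: leeD; [|apply: leeD]; rewrite [leRHS]EFinM.
  - by apply: lee_wpmul2l => //; rewrite lee_fin ltW.
  - by apply: lee_wpmul2l => //; rewrite lee_fin.
  - by apply: lee_wpmul2l => //; rewrite lee_fin.
have : (C%:E <= fd_expect sigma weight + (3 * (C / 4))%:E)%E.
  rewrite -(fd_expect_cst n sigma M10 M20 C).
  apply: (@le_trans _ _ (fd_expect sigma weight + fd_expect sigma bad)%E); last exact: leeD2l.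
  rewrite -fd_expectD//; apply: le_fd_expect => //.
  - by move=> s1 s2 z1 z2; exact: ltW.
  - by move=> s1 s2; apply: measurable_funD; [exact: mweight|exact: mbad].
move=> Cle; rewrite (_ : C / 4 = C - 3 * (C / 4)); last by field.
by rewrite EFinB leeBlDr.
Qed.

(** [r] rescales the interference in [y1] to the uplink signal in [y2]. [A] and [V] add up the
    denominators for [sqr_divD_le]: [y1] consists of two inputs and [z1], the deviation of [y2] of
    [z2] and [- r z1]. *)
Let r := g2 / g21.
Let A := g1 ^+ 2 * P1 + g21 ^+ 2 * P2 + 4 * sigma ^+ 2.
Let V := sigma ^+ 2 * (2 + 4 * r ^+ 2).

Let s2_gt0 : 0 < sigma ^+ 2. Proof. exact: exprn_gt0. Qed.
Let u1_gt0 : 0 < g1 ^+ 2 * P1.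
Proof. by rewrite mulr_gt0// exprn_even_gt0. Qed.
Let u2_gt0 : 0 < g21 ^+ 2 * P2.
Proof. by rewrite mulr_gt0// exprn_even_gt0. Qed.
Let A_gt0 : 0 < A. Proof. by rewrite !addr_gt0// mulr_gt0. Qed.
Let r0 : r != 0. Proof. by rewrite mulf_neq0// invr_neq0. Qed.
Let V_gt0 : 0 < V.
Proof. by rewrite mulr_gt0// addr_gt0// mulr_gt0// exprn_even_gt0. Qed.

(* Estimate of [y2] from [y1] once the downlink signal is removed: the
   deviation of the true [y2] from it is [z2 - r z1], whatever [s2] is. *)
Let center s1 (y1 : n.-tuple R) i (y2 : n.-tuple R) : R :=
  r * (tnth y1 i - g1 * enc1 c s1 i y2).

Let profile1 (y1 : n.-tuple R) : R := \prod_(i < n) expR (- (tnth y1 i - 0) ^+ 2 / A).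
Let profile2 s1 y1 (y2 : n.-tuple R) : R :=
  \prod_(i < n) expR (- (tnth y2 i - center s1 y1 i y2) ^+ 2 / V).

(* Half of the Gaussian exponent of [z1] goes to each of the two profiles. *)
Let density_le (x1 x2 z1 z2 : R) :
  (normal_pdf 0 sigma z1 * normal_pdf 0 sigma z2) * expR (- (x1 ^+ 2 / P1 + x2 ^+ 2 / P2)) <=
  normal_peak sigma ^+ 2 * (expR (- (g1 * x1 + g21 * x2 + z1 - 0) ^+ 2 / A) *
    expR (- (g2 * x2 + z2 - r * (g1 * x1 + g21 * x2 + z1 - g1 * x1)) ^+ 2 / V)).
Proof.
rewrite normal_pdfE ?gt_eqF// /normal_fun mulrACA -expr2 -mulrA.
apply: ler_wpM2l; first exact: sqr_ge0.
rewrite -!expRD ler_expR !subr0.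
have h1 : (g1 * x1 + g21 * x2 + z1) ^+ 2 / A <=
    x1 ^+ 2 / P1 + x2 ^+ 2 / P2 + z1 ^+ 2 / (4 * sigma ^+ 2).
  apply: le_trans (sqr_divD_le _ _ _ _) _; [exact: addr_gt0|exact: mulr_gt0|].
  rewrite lerD2r; apply: le_trans (sqr_divD_le _ _ u1_gt0 u2_gt0) _.
  rewrite le_eqVlt; apply/orP; left; apply/eqP; field.
  by rewrite g10 g210 !gt_eqF.
have h2 : (g2 * x2 + z2 - r * (g1 * x1 + g21 * x2 + z1 - g1 * x1)) ^+ 2 / V <=
    z2 ^+ 2 / (2 * sigma ^+ 2) + z1 ^+ 2 / (4 * sigma ^+ 2).
  have -> : g2 * x2 + z2 - r * (g1 * x1 + g21 * x2 + z1 - g1 * x1) = z2 + - r * z1.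
    by rewrite /r; field.
  have -> : V = 2 * sigma ^+ 2 + r ^+ 2 * (4 * sigma ^+ 2) by rewrite /V; ring.
  apply: le_trans (sqr_divD_le _ _ _ _) _; [exact: mulr_gt0| |].
    by rewrite mulr_gt0 ?exprn_even_gt0// mulr_gt0.
  rewrite lerD2l le_eqVlt; apply/orP; left; apply/eqP; field.
  by rewrite r0 gt_eqF.
have e1 : - z1 ^+ 2 / (sigma ^+ 2 *+ 2) =
    - (z1 ^+ 2 / (4 * sigma ^+ 2) + z1 ^+ 2 / (4 * sigma ^+ 2)).
  by field; rewrite gt_eqF.
have e2 : - z2 ^+ 2 / (sigma ^+ 2 *+ 2) = - (z2 ^+ 2 / (2 * sigma ^+ 2)).
  by field; rewrite gt_eqF.
rewrite e1 e2 !mulNr; lra.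
Qed.

(** Comparison density on output pairs, cut to the decoding regions; [s2] enters through its region
    only. *)
Let D s1 s2 y1 y2 : R := ok s1 s2 y1 y2 * (profile1 y1 * profile2 s1 y1 y2).

Let profile1_ge0 y1 : 0 <= profile1 y1.
Proof. by apply: prodr_ge0 => i _; exact: expR_ge0. Qed.

Let profile2_ge0 s1 y1 y2 : 0 <= profile2 s1 y1 y2.
Proof. by apply: prodr_ge0 => i _; exact: expR_ge0. Qed.

Let D_ge0 s1 s2 y1 y2 : 0 <= D s1 s2 y1 y2.
Proof. by rewrite mulr_ge0// mulr_ge0. Qed.

Let weight_density s1 s2 z1 z2 :
  weight s1 s2 z1 z2 * ((\prod_(i < n) normal_pdf 0 sigma (tnth z1 i)) *
     (\prod_(i < n) normal_pdf 0 sigma (tnth z2 i))) <=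
  normal_peak sigma ^+ 2 ^+ n * D s1 s2 (sig_y1 g1 g2 g21 c s1 s2 z1 z2) (sig_y2 g2 c s2 z2).
Proof.
rewrite /weight /D -mulrA [leRHS]mulrCA; apply: ler_wpM2l => //.
rewrite /cost /pow1 /pow2 !mulr_suml -big_split/= -sumrN expR_sum -!big_split/=.
have -> : normal_peak sigma ^+ 2 ^+ n = \prod_(i < n) normal_peak sigma ^+ 2.
  by rewrite prodr_const card_ord.
rewrite -big_split/=.
apply: ler_prod => i _; rewrite mulr_ge0 ?expR_ge0 ?mulr_ge0 ?normal_pdf_ge0//=.
by rewrite mulrC /center !tnth_mktuple; exact: density_le.
Qed.

Let mprofile1 : measurable_fun [set: n.-tuple R] profile1.
Proof.
apply: measurable_prod => i _; apply: measurableT_comp => //.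
apply: measurable_funM => //; apply: measurableT_comp => //.
by apply: measurable_funX; exact: measurable_funB.
Qed.

Let mprofile2 s1 : measurable_fun [set: n.-tuple R * n.-tuple R]
  (fun p => profile2 s1 p.1 p.2).
Proof.
apply: measurable_prod => i _; apply: measurableT_comp => //.
apply: measurable_funM => //; apply: measurableT_comp => //.
apply: measurable_funX; apply: measurable_funB.
  exact: (measurableT_comp (mtnth i)).
apply: measurable_funM => //; apply: measurable_funB.
  exact: (measurableT_comp (mtnth i)).
apply: measurable_funM => //; case: cv => _ menc _ _.
exact: (measurableT_comp (menc s1 i)).
Qed.

Let mD s1 s2 : measurable_fun [set: n.-tuple R * n.-tuple R]
  (fun p => D s1 s2 p.1 p.2).
Proof.
apply: measurable_funM.
  apply: measurable_funM; first exact: (measurableT_comp (mdec1 s1)).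
  exact: (measurableT_comp (mdec2 s1 s2)).
apply: measurable_funM; last exact: mprofile2.
exact: (measurableT_comp mprofile1).
Qed.

Let mpdf : measurable_fun [set: n.-tuple R]
  (fun z => \prod_(i < n) normal_pdf 0 sigma (tnth z i)).
Proof.
apply: measurable_prod => i _.
by apply: measurableT_comp; [exact: measurable_normal_pdf|exact: mtnth].
Qed.

Let pdf_ge0 (z : n.-tuple R) : 0 <= \prod_(i < n) normal_pdf 0 sigma (tnth z i).
Proof. by apply: prodr_ge0 => i _; exact: normal_pdf_ge0. Qed.

Let mDsig s1 s2 : measurable_fun [set: n.-tuple R * n.-tuple R]
  (fun p => D s1 s2 (sig_y1 g1 g2 g21 c s1 s2 p.1 p.2) (sig_y2 g2 c s2 p.2)).
Proof.
apply: (measurable_comp2 (mD s1 s2)); first exact: my1.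
exact: (measurableT_comp (my2 s2)).
Qed.

Let to_lebesgue s1 s2 :
  (gauss_int sigma (fun z1 => gauss_int sigma (fun z2 => (weight s1 s2 z1 z2)%:E)) <=
   (normal_peak sigma ^+ 2 ^+ n)%:E *
   tint leb (fun z1 => tint leb (fun z2 =>
     (D s1 s2 (sig_y1 g1 g2 g21 c s1 s2 z1 z2) (sig_y2 g2 c s2 z2))%:E)))%E.
Proof.
have inner z1 : gauss_int sigma (fun z2 => (weight s1 s2 z1 z2)%:E) =
    tint leb (fun z2 => (weight s1 s2 z1 z2 * \prod_(i < n) normal_pdf 0 sigma (tnth z2 i))%:E).
  rewrite gauss_int_lebesgue//; last exact: (measurable_section z1 (mweight s1 s2)).
  by move=> z2; rewrite lee_fin.
under [X in gauss_int _ X]eq_fun do rewrite inner.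
pose F z1 z2 : R := weight s1 s2 z1 z2 * \prod_(i < n) normal_pdf 0 sigma (tnth z2 i).
have m1 : measurable_fun [set: n.-tuple R * n.-tuple R] (fun p => F p.1 p.2).
  apply: measurable_funM; first exact: mweight.
  exact: (measurableT_comp mpdf).
have w10 z1 z2 : 0 <= F z1 z2 by rewrite mulr_ge0.
rewrite gauss_int_lebesgue; first last.
- exact: (measurable_tint2 leb w10 m1).
- by move=> z1; apply: tint_ge0 => z2; rewrite lee_fin; exact: w10.
have e z1 : (tint leb (fun z2 =>
      (weight s1 s2 z1 z2 * \prod_(i < n) normal_pdf 0 sigma (tnth z2 i))%:E)
    * (\prod_(i < n) normal_pdf 0 sigma (tnth z1 i))%:E =
    tint leb (fun z2 => (weight s1 s2 z1 z2 * ((\prod_(i < n) normal_pdf 0 sigma (tnth z1 i)) *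
     (\prod_(i < n) normal_pdf 0 sigma (tnth z2 i))))%:E))%E.
  rewrite muleC -tintZl//; first last.
  - exact: (measurable_section (F := F) z1 m1).
  - by move=> z2; rewrite lee_fin; exact: w10.
  by apply: eq_tint => z2; rewrite -EFinM mulrCA.
rewrite (eq_tint _ e) -(@dintZl _ n leb) => //; first last.
- exact: exprn_ge0 (sqr_ge0 _).
apply: (le_dint leb).
- by move=> z1 z2; rewrite mulr_ge0// mulr_ge0.
- apply: measurable_funM; first exact: mweight.
  by apply: measurable_funM; [exact: (measurableT_comp mpdf)|exact: (measurableT_comp mpdf)].
- by apply: measurable_funM => //; exact: mDsig.
- by move=> z1 z2; exact: weight_density.
Qed.

Let mD_swap s1 s2 : measurable_fun [set: n.-tuple R * n.-tuple R]
  (fun p => D s1 s2 p.2 p.1).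
Proof. exact: (measurable_comp2 (mD s1 s2)). Qed.

(** For fixed [z2] the passage from [z1] to [y1] is a translation, by an amount depending on [z2]
    through the encoder. Hence [z1] is integrated innermost first, then [z2] is translated to [y2],
    and the order is restored. *)
Let change_variables s1 s2 :
  tint leb (fun z1 => tint leb (fun z2 =>
     (D s1 s2 (sig_y1 g1 g2 g21 c s1 s2 z1 z2) (sig_y2 g2 c s2 z2))%:E)) =
  tint leb (fun y1 => tint leb (fun y2 => (D s1 s2 y1 y2)%:E)).
Proof.
rewrite (tint_swap leb (f := fun z1 z2 =>
  (D s1 s2 (sig_y1 g1 g2 g21 c s1 s2 z1 z2) (sig_y2 g2 c s2 z2))%:E)); first last.
- by apply/measurable_EFinP; exact: mDsig.
- by move=> z1 z2; rewrite lee_fin.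
have D0 y2 y1 : 0 <= D s1 s2 y1 y2 by exact: D_ge0.
have inner z2 y2 : tint leb (fun z1 => (D s1 s2 (sig_y1 g1 g2 g21 c s1 s2 z1 z2) y2)%:E) =
    tint leb (fun y1 => (D s1 s2 y1 y2)%:E).
  apply: (@tint_shift R n _ (fun y1 => (D s1 s2 y1 y2)%:E)).
  - by move=> t; rewrite lee_fin.
  - exact: (measurable_section (F := fun y2 y1 => D s1 s2 y1 y2) y2 (mD_swap s1 s2)).
under eq_tint do rewrite inner.
rewrite (@tint_shift R n _ (fun y2 => tint leb (fun y1 => (D s1 s2 y1 y2)%:E))); first last.
- exact: (measurable_tint2 (F := fun y2 y1 => D s1 s2 y1 y2) leb D0 (mD_swap s1 s2)).
- by move=> y2; apply: tint_ge0 => y1; rewrite lee_fin.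
rewrite (tint_swap leb (f := fun y2 y1 => (D s1 s2 y1 y2)%:E))//.
by apply/measurable_EFinP; exact: mD_swap.
Qed.

Let sum_indic M (m : 'I_M) : \sum_(s < M) (m == s)%:R = 1 :> R.
Proof.
rewrite (bigD1 m)//= eqxx big1 ?addr0// => s sm.
by rewrite eq_sym (negbTE sm).
Qed.

(** The regions of [s2] partition the [y2] space. The center at time [i] uses only earlier
    coordinates of [y2], so the Gaussian factors integrate out one by one. *)
Let sum_D s1 y1 :
  (\sum_(s2 < M2) tint leb (fun y2 => (D s1 s2 y1 y2)%:E) =
   ((dec1 c y1 == s1)%:R * profile1 y1 * Num.sqrt (pi * V) ^+ n)%:E)%E.
Proof.
rewrite -tint_sum; first last.
- by move=> s2; exact: (measurable_section y1 (mD s1 s2)).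
- by move=> s2 y2; rewrite lee_fin.
pose k := (dec1 c y1 == s1)%:R * profile1 y1.
pose f i y (y2 : n.-tuple R) := expR (- (y - center s1 y1 i y2) ^+ 2 / V).
rewrite (@eq_tint _ leb _ _ (fun y2 => (k * \prod_(i < n) f i (tnth y2 i) y2)%:E)).
  rewrite (@tint_prod_causal _ leb n f (fun=> Num.sqrt (pi * V)) k).
  - by rewrite prodr_const card_ord.
  - by rewrite mulr_ge0.
  - by move=> i y t; exact: expR_ge0.
  - by move=> i; exact: sqrtr_ge0.
  - move=> i y t t' tt'; rewrite /f /center.
    by case: cv => causal _ _ _; rewrite (causal s1 i t t' tt').
  - move=> i t; apply: measurableT_comp => //; apply: measurable_funM => //.
    apply: measurableT_comp => //; apply: measurable_funX.
    exact: measurable_funB.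
  - by move=> i t; exact: integral_gaussian.
move=> y2; rewrite sumEFin; congr (_%:E); rewrite /k.
rewrite (eq_bigr (fun s2 => (dec2 c s1 y2 == s2)%:R *
    ((dec1 c y1 == s1)%:R * (profile1 y1 * profile2 s1 y1 y2)))).
  by rewrite -mulr_suml sum_indic mul1r mulrA.
by move=> s2 _; rewrite /D /ok; ring.
Qed.

(** Once [sum_D] has removed [profile2], only the indicator of [dec1] depends on [s1], and the
    regions of [s1] merge as well. *)
Let sum_tint_D :
  (\sum_(s1 < M1) \sum_(s2 < M2) tint leb (fun y1 => tint leb (fun y2 => (D s1 s2 y1 y2)%:E)) =
  (Num.sqrt (pi * V) ^+ n * Num.sqrt (pi * A) ^+ n)%:E)%E.
Proof.
have B0 s1 y1 : 0 <= (dec1 c y1 == s1)%:R * profile1 y1 * Num.sqrt (pi * V) ^+ n.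
  by rewrite mulr_ge0 ?exprn_ge0 ?sqrtr_ge0// mulr_ge0.
rewrite (eq_bigr (fun s1 => tint leb (fun y1 =>
    ((dec1 c y1 == s1)%:R * profile1 y1 * Num.sqrt (pi * V) ^+ n)%:E))); last first.
  move=> s1 _; rewrite -tint_sum.
  - by apply: eq_tint => y1; exact: sum_D.
  - by move=> s2 y1; apply: tint_ge0 => y2; rewrite lee_fin.
  - by move=> s2; exact: (measurable_tint2 leb (D_ge0 s1 s2) (mD s1 s2)).
rewrite -tint_sum; first last.
- move=> s1; apply/measurable_EFinP; apply: measurable_funM => //.
  by apply: measurable_funM.
- by move=> s1 y1; rewrite lee_fin.
pose f (i : 'I_n) y (_ : n.-tuple R) := expR (- (y - 0) ^+ 2 / A).
rewrite (@eq_tint _ leb _ _ (fun y1 => (Num.sqrt (pi * V) ^+ n *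
    \prod_(i < n) f i (tnth y1 i) y1)%:E)).
  rewrite (@tint_prod_causal _ leb n f (fun=> Num.sqrt (pi * A))).
  - by rewrite prodr_const card_ord.
  - by rewrite exprn_ge0// sqrtr_ge0.
  - by move=> i y t; exact: expR_ge0.
  - by move=> i; exact: sqrtr_ge0.
  - by [].
  - move=> i t; apply: measurableT_comp => //; apply: measurable_funM => //.
    apply: measurableT_comp => //; apply: measurable_funX.
    exact: measurable_funB.
  - by move=> i t; exact: integral_gaussian.
move=> y1; rewrite sumEFin; congr (_%:E).
by rewrite -mulr_suml -mulr_suml sum_indic mul1r mulrC.
Qed.

Let kappa : R := normal_peak sigma ^+ 2 * (Num.sqrt (pi * V) * Num.sqrt (pi * A)).

Lemma weight_upper_bound :
  (fd_expect sigma weight <= ((M1 * M2)%:R^-1 * kappa ^+ n)%:E)%E.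
Proof.
rewrite EFinM; apply: lee_wpmul2l; first by rewrite lee_fin invr_ge0.
apply: (@le_trans _ _ (\sum_(s1 < M1) \sum_(s2 < M2) ((normal_peak sigma ^+ 2 ^+ n)%:E *
   tint leb (fun y1 => tint leb (fun y2 => (D s1 s2 y1 y2)%:E))))%E).
  apply: lee_sum => s1 _; apply: lee_sum => s2 _.
  by rewrite -change_variables; exact: to_lebesgue.
have T0 s1 s2 : (0 <= tint leb (fun y1 => tint leb (fun y2 => (D s1 s2 y1 y2)%:E)))%E.
  by apply: tint_ge0 => y1; apply: tint_ge0 => y2; rewrite lee_fin.
under eq_bigr do rewrite -ge0_sume_distrr//.
rewrite -ge0_sume_distrr; last by move=> s1 _; apply: sume_ge0.
by rewrite sum_tint_D -EFinM /kappa !exprMn.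
Qed.

(** The first factor is [SNR1 + INR + 4] and the second depends only on [g2 / g21], so [kappa] grows
    like the square root of the SNRs. *)
Let kappa2 : kappa ^+ 2 = (A / sigma ^+ 2) * (V / sigma ^+ 2) / 4.
Proof.
rewrite /kappa /normal_peak 2!exprMn exprVn sqr_sqrtr; last first.
  by rewrite mulrn_wge0// mulr_ge0 ?sqr_ge0// pi_ge0.
rewrite exprMn !sqr_sqrtr; last 2 first.
- by rewrite mulr_ge0 ?pi_ge0// ltW.
- by rewrite mulr_ge0 ?pi_ge0// ltW.
have pi0 : pi != 0 :> R by rewrite gt_eqF// pi_gt0.
by move: (pi : R) pi0 => p p0; field; rewrite p0 gt_eqF.
Qed.

Let kappa_gt0 : 0 < kappa.
Proof.
rewrite /kappa mulr_gt0//.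
  by rewrite exprn_gt0// normal_peak_gt0// gt_eqF.
by rewrite mulr_gt0// sqrtr_gt0 mulr_gt0// pi_gt0.
Qed.

Lemma code_size_le :
  (fd_pow1 g2 c sigma <= P1%:E)%E -> (fd_pow2 c sigma <= P2%:E)%E ->
  (fd_perr g1 g2 g21 c sigma <= (4^-1)%:E)%E ->
  ln (M1%:R : R) + ln M2%:R <= ln 4 + n%:R * (4 + ln
    (((g1 ^+ 2 * P1 + g21 ^+ 2 * P2 + 4 * sigma ^+ 2) / sigma ^+ 2) *
     (2 + 4 * (g2 / g21) ^+ 2) / 4) / 2).
Proof.
move=> hp1 hp2 herr.
have := le_trans (weight_lower_bound hp1 hp2 herr) weight_upper_bound.
rewrite lee_fin => le.
have M0 : 0 < (M1 * M2)%:R :> R by rewrite ltr0n muln_gt0 M10.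
have M10' : 0 < M1%:R :> R by rewrite ltr0n.
have M20' : 0 < M2%:R :> R by rewrite ltr0n.
rewrite -lnM ?posrE// -natrM.
have {}le : (M1 * M2)%:R <= 4 * (expR (4 * n%:R) * kappa ^+ n).
  move: le; rewrite expRN [leRHS]mulrC ler_pdivlMr// => le.
  have E0 : 0 < 4 * expR (4 * n%:R) :> R by rewrite mulr_gt0// expR_gt0.
  rewrite -(ler_pM2l E0) in le; rewrite mulrA; apply: le_trans le.
  rewrite le_eqVlt; apply/orP; left; apply/eqP.
  by field; rewrite gt_eqF// expR_gt0.
apply: (@le_trans _ _ (ln (4 * (expR (4 * n%:R) * kappa ^+ n)))).
  by rewrite ler_ln ?posrE// !mulr_gt0 ?expR_gt0 ?exprn_gt0.
rewrite lnM ?posrE ?mulr_gt0 ?expR_gt0 ?exprn_gt0// lerD2l.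
rewrite lnM ?posrE ?expR_gt0 ?exprn_gt0// expRK lnXn// -[_ *+ n]mulr_natr.
have -> : 2 + 4 * (g2 / g21) ^+ 2 = V / sigma ^+ 2.
  by rewrite /V /r; field; rewrite g210 gt_eqF.
rewrite -/A -kappa2 lnXn//.
rewrite le_eqVlt; apply/orP; left; apply/eqP.
by rewrite -[_ *+ 2]mulr_natr; field.
Qed.

End code_bound.

(** * Asymptotics *)

Section asymptotics.
Context {R : realType}.

(** Removes the block length: if [y < x], any [n] beyond [|C| / (x - y)] breaks the inequality. *)
Lemma le_of_linear_le (x y C : R) (N : nat) :
  (forall n : nat, (N <= n)%N -> n%:R * x <= C + n%:R * y) -> x <= y.
Proof.
move=> h; rewrite leNgt; apply/negP => yx.
pose n := maxn N (Num.truncn (`|C| / (x - y))).+1.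
have := h n (leq_maxl _ _).
have : C < n%:R * (x - y).
  rewrite -ltr_pdivrMr ?subr_gt0//.
  apply: le_lt_trans (_ : `|C| / (x - y) < _).
    by rewrite ler_pM2r ?invr_gt0 ?subr_gt0// ler_norm.
  by apply: lt_le_trans (truncnS_gt _) _; rewrite ler_nat leq_maxr.
lra.
Qed.

Lemma ler_ln_of_powR (x k : R) : 2 `^ x <= k -> 0 < k /\ x * ln 2 <= ln k.
Proof.
move=> le; have x0 : 0 < 2 `^ x :> R by exact: powR_gt0.
have k0 : 0 < k by exact: lt_le_trans le.
by split => //; rewrite -ln_powR ler_ln ?posrE.
Qed.

Section sum_capacity.
Variables (W sigma g1 g2 g21 P1 P2 : R).
Hypotheses (W0 : 0 < W) (sigma0 : 0 < sigma) (P10 : 0 < P1) (P20 : 0 < P2).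
Hypotheses (g10 : g1 != 0) (g20 : g2 != 0) (g210 : g21 != 0).

Let ln20 : 0 < ln 2 :> R. Proof. by rewrite ln_gt0// ltr1n. Qed.

Let B : R := ((g1 ^+ 2 * P1 + g21 ^+ 2 * P2 + 4 * sigma ^+ 2) / sigma ^+ 2) *
     (2 + 4 * (g2 / g21) ^+ 2) / 4.

Lemma achievable_sum_le R1 R2 :
  fd_achievable W sigma g1 g2 g21 P1 P2 R1 R2 ->
  R1 + R2 <= (8 + ln B) * (W / ln 2).
Proof.
move=> /(_ 4^-1 (ltac:(by rewrite invr_gt0)))[N hN].
have -> : R1 + R2 = ((R1 + R2) * ln 2 / W) * (W / ln 2).
  by field; rewrite !gt_eqF.
rewrite ler_pM2r ?divr_gt0//.
(* The [2 W] channel uses per second halve the exponents of the message counts; doubling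
   [code_size_le] gives [2 ln 4] and [8 + ln B]. *)
apply: (@le_of_linear_le _ _ (2 * ln 4) N.+1) => n Nn.
have n0 : (0 < n)%N by exact: leq_ltn_trans Nn.
have [M1 [M2 [c [cv [/ler_ln_of_powR[M10 hM1] /ler_ln_of_powR[M20 hM2] h1 h2 he]]]]] :=
  hN n (ltnW Nn).
rewrite !ltr0n in M10 M20.
have := code_size_le n0 M10 M20 sigma0 P10 P20 g10 g20 g210 cv h1 h2 he.
rewrite -/B; move: hM1 hM2.
have -> : n%:R * R1 / (2 * W) * ln 2 = n%:R * (R1 * ln 2 / W) / 2.
  by field; rewrite gt_eqF.
have -> : n%:R * R2 / (2 * W) * ln 2 = n%:R * (R2 * ln 2 / W) / 2.
  by field; rewrite gt_eqF.
have -> : n%:R * ((R1 + R2) * ln 2 / W) = n%:R * (R1 * ln 2 / W) + n%:R * (R2 * ln 2 / W).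
  by field; rewrite gt_eqF.
lra.
Qed.

(** The uplink-only rate pair makes the set of sum rates nonempty and the converse bounds it, so
    [sup] is its least upper bound. *)
Lemma fd_sumcap_bounds (m : nat) : (0 < m)%N ->
  8 * (8 * m%:R) ^+ 2 * sigma ^+ 2 <= g2 ^+ 2 * P2 ->
  2 * W * (ln m%:R / ln 2) <= fd_sumcap W sigma g1 g2 g21 P1 P2 <= (8 + ln B) * (W / ln 2).
Proof.
move=> m0 hm; rewrite /fd_sumcap; set S := [set r | _].
have SE : S (2 * W * (ln m%:R / ln 2)).
  exists 0, (2 * W * (ln m%:R / ln 2)); split => //; last by rewrite add0r.
    apply: mulr_ge0; first by rewrite mulr_ge0// ltW.
    by apply: divr_ge0; [rewrite ln_ge0// ler1n|exact: ltW].
  exact: (pam_achievable g1 g21 sigma0 P20 m0 hm W0 P10).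
have ubS : ubound S ((8 + ln B) * (W / ln 2)).
  by move=> _ [R1 [R2 [_ _ ach ->]]]; exact: achievable_sum_le.
apply/andP; split.
  by apply: ub_le_sup => //; exists ((8 + ln B) * (W / ln 2)).
by apply: ge_sup => //; exists (2 * W * (ln m%:R / ln 2)).
Qed.

End sum_capacity.

Lemma cvg_ratio_log (k K : R) (u v : R -> R) : 0 < k ->
  (\forall t \near +oo, `|u t * k - ln t| <= K) ->
  (\forall t \near +oo, `|v t * k - ln t| <= K) ->
  (u t / v t) @[t --> +oo] --> (1 : R).
Proof.
move=> k0 hu hv; apply/cvgrPdist_le => e e0.
near=> t.
have ut : `|u t * k - ln t| <= K by near: t.
have vt : `|v t * k - ln t| <= K by near: t.
have K0 : 0 <= K by exact: le_trans ut.
have t0 : 0 < t by near: t; exact: nbhs_pinfty_gt.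
(* Past this threshold [v t * k] is at least [2 K / e + 1], while it differs from [u t * k] by at
   most [2 K]. *)
have tbig' : expR (K + 2 * K / e + 1) <= t.
  by near: t; apply: nbhs_pinfty_ge; exact: num_real.
have tbig : K + 2 * K / e + 1 <= ln t.
  by rewrite -[leLHS]expRK ler_ln ?posrE ?expR_gt0.
have Ke : 0 <= 2 * K / e by rewrite divr_ge0 ?mulr_ge0// ltW.
have vk : 2 * K / e <= v t * k.
  by move: vt; rewrite ler_norml => /andP[+ _]; lra.
have v0 : 0 < v t * k.
  by move: vt; rewrite ler_norml => /andP[+ _]; lra.
have -> : 1 - u t / v t = (v t * k - u t * k) / (v t * k).
  have vt0 : v t != 0 by apply: contraTneq v0 => ->; rewrite mul0r ltxx.
  by field; rewrite vt0 gt_eqF.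
rewrite normrM normfV (gtr0_norm v0) ler_pdivrMr//.
apply: (@le_trans _ _ (2 * K)).
  rewrite (_ : _ - _ = (v t * k - ln t) - (u t * k - ln t)); last by ring.
  by apply: le_trans (ler_normB _ _) _; rewrite mulr_natl mulr2n lerD.
by rewrite [leRHS]mulrC -ler_pdivrMr.
Unshelve. all: by end_near.
Qed.

Lemma log_affine_bound (x lnt lo hi : R) :
  lnt + lo <= x -> x <= lnt + hi -> `|x - lnt| <= `|lo| + `|hi|.
Proof.
move=> h1 h2; rewrite ler_norml.
have := ler_norm hi; have := ler_norm (- lo); rewrite normrN.
by have := normr_ge0 hi; have := normr_ge0 lo; lra.
Qed.

Lemma g_approx_log (W a1 a2 b : R) : 0 < W -> 0 < a1 -> 0 < a2 -> 0 < b ->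
  exists K : R, \forall t \near +oo,
    `|g_approx W (a1 * t) (a2 * t) (b * t) * (ln 2 / W) - ln t| <= K.
Proof.
move=> W0 a10 a20 b0.
have ln20 : 0 < ln 2 :> R by rewrite ln_gt0// ltr1n.
have capE x : capC W x * (ln 2 / W) = ln (1 + x).
  by rewrite /capC; field; rewrite !gt_eqF.
(* From [a t <= 1 + a t <= (1 + a) t]. *)
have lnaff a (t : R) : 0 < a -> 1 <= t -> ln t + ln a <= ln (1 + a * t) <= ln t + ln (1 + a).
  move=> a0 t1; have t0 : 0 < t by exact: lt_le_trans t1.
  rewrite -!lnM ?posrE ?addr_gt0// !ler_ln ?posrE ?mulr_gt0 ?addr_gt0 ?mulr_gt0//.
  by apply/andP; split; nra.
have [ba2|a2b] := leP b a2.
  exists (`|ln a2| + `|ln (1 + a2) + ln (1 + a1 / b)|); near=> t.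
  have t1 : 1 <= t by near: t; apply: nbhs_pinfty_ge; exact: num_real.
  have t0 : 0 < t by exact: lt_le_trans t1.
  have /andP[l1 l2] := lnaff _ _ a20 t1.
  have bt0 : 0 < 1 + b * t by rewrite addr_gt0// mulr_gt0.
  have q0 : 0 <= a1 * t / (1 + b * t) by rewrite divr_ge0 ?mulr_ge0 ?ltW.
  (* Interference grows in proportion to the downlink signal, so the downlink term stays bounded and
     the uplink term carries all of [ln t]. *)
  have q1 : a1 * t / (1 + b * t) <= a1 / b.
    rewrite ler_pdivrMr// mulrAC ler_pdivlMr//; nra.
  have l3 : 0 <= ln (1 + a1 * t / (1 + b * t)) by apply: ln_ge0; rewrite lerDl.
  have l4 : ln (1 + a1 * t / (1 + b * t)) <= ln (1 + a1 / b).
    by rewrite ler_ln ?posrE ?lerD2l// ltr_wpDr// divr_ge0 ?ltW.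
  rewrite /g_approx ler_pM2r// ba2 mulrDl !capE.
  by apply: log_affine_bound; lra.
exists (`|ln (a1 + b)| + `|ln (1 + (a1 + b))|); near=> t.
have t1 : 1 <= t by near: t; apply: nbhs_pinfty_ge; exact: num_real.
have t0 : 0 < t by exact: lt_le_trans t1.
(* From here on [b t <= a2 t (1 + a1 t)], which selects the second branch of [g_approx]. *)
have tb : b / a2 / a1 <= t by near: t; apply: nbhs_pinfty_ge; exact: num_real.
have /andP[l1 l2] := lnaff _ _ (addr_gt0 a10 b0) t1.
rewrite /g_approx ler_pM2r// (lt_geF a2b) ifT.
  by rewrite -mulrDl capE; exact: log_affine_bound.
move: tb; rewrite -mulrA -invfM ler_pdivrMr ?mulr_gt0// => tb.
by rewrite mulrAC ler_pM2r//; nra.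
Unshelve. all: by end_near.
Qed.

End asymptotics.

(* SNR1 = a1 t, SNR2 = a2 t, INR = b t with fixed ratios, t -> +oo; the
   channel parameters (sigma, gamma_1, gamma_2, gamma_21, P1, P2) realising
   these SNRs may be chosen arbitrarily as functions of t. *)
Theorem theorem4 (R : realType) (W a1 a2 b : R)
  (sigma g1 g2 g21 P1 P2 : R -> R) :
  0 < W -> 0 < a1 -> 0 < a2 -> 0 < b ->
  (forall t, 0 < t ->
     [/\ 0 < sigma t, 0 < P1 t & 0 < P2 t] /\
     [/\ g1 t ^+ 2 * P1 t / sigma t ^+ 2 = a1 * t,
         g2 t ^+ 2 * P2 t / sigma t ^+ 2 = a2 * t &
         g21 t ^+ 2 * P2 t / sigma t ^+ 2 = b * t]) ->
  (fd_sumcap W (sigma t) (g1 t) (g2 t) (g21 t) (P1 t) (P2 t)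
     / g_approx W (a1 * t) (a2 * t) (b * t)) @[t --> +oo] --> (1 : R).
Proof.
move=> W0 a10 a20 b0 chan.
have ln20 : 0 < ln 2 :> R by rewrite ln_gt0// ltr1n.
(* With [a2 = 512 k] the condition [8 (8 m)^2 <= SNR2] reads [m^2 <= k t]. *)
have [k k0 a2E] : exists2 k, 0 < k & a2 = 8 * (8 * (8 * k)).
  by exists (a2 / 8 / 8 / 8); [rewrite !divr_gt0|field].
have [Kg hg] := g_approx_log W0 a10 a20 b0.
(* Since [(g2 / g21)^2 = SNR2 / INR = a2 / b], this factor of the converse constant is the same for
   all [t]. *)
have [c c0 cE] : exists2 c, 0 < c & c = (2 + 4 * (a2 / b)) / 4.
  exists ((2 + 4 * (a2 / b)) / 4) => //.
  by rewrite divr_gt0// addr_gt0// mulr_gt0// divr_gt0.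
pose K := `|ln (k / 4)| + `|8 + ln ((a1 + b + 4) * c)|.
apply: (@cvg_ratio_log _ (ln 2 / W) (K + Kg)).
- by rewrite divr_gt0.
- near=> t.
  have t1 : 1 <= t by near: t; apply: nbhs_pinfty_ge; exact: num_real.
  have t0 : 0 < t by exact: lt_le_trans t1.
  have tbig : 4 / k <= t by near: t; apply: nbhs_pinfty_ge; exact: num_real.
  have gK : `|g_approx W (a1 * t) (a2 * t) (b * t) * (ln 2 / W) - ln t| <= Kg.
    by near: t; exact: hg.
  have Kg0 : 0 <= Kg by exact: le_trans gK.
  have [[s0 P10 P20] [e1 e2 e3]] := chan t t0.
  have nz g P a : 0 < a -> g ^+ 2 * P / sigma t ^+ 2 = a * t -> g != 0.
    move=> a0 e; apply/eqP => g0; move: e; rewrite g0 expr0n /= !mul0r => /esym/eqP.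
    by rewrite gt_eqF// mulr_gt0.
  have s20 : 0 < sigma t ^+ 2 by exact: exprn_gt0.
  pose s := Num.sqrt (k * t).
  have ss : s ^+ 2 = k * t by rewrite sqr_sqrtr// mulr_ge0 ?ltW.
  have s_ge2 : 2 <= s.
    rewrite -(@ler_pXn2r _ 2) ?nnegrE ?sqrtr_ge0// ss.
    by move: tbig; rewrite ler_pdivrMr// mulrC; lra.
  (* The largest admissible [m]. As [s >= 2], rounding down loses at most a factor 2, hence
     [ln (k / 4)] in [K]. *)
  pose m := Num.truncn s.
  have ms : m%:R <= s by rewrite truncn_le// sqrtr_ge0.
  have sm : s / 2 <= m%:R.
    have := truncnS_gt s; rewrite -/m -natr1; lra.
  have m0 : (0 < m)%N by rewrite -(ltr_nat R); lra.
  have hm : 8 * (8 * m%:R) ^+ 2 * sigma t ^+ 2 <= g2 t ^+ 2 * P2 t.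
    rewrite -ler_pdivlMr// e2.
    have : m%:R ^+ 2 <= s ^+ 2 by apply: lerXn2r; rewrite ?nnegrE ?sqrtr_ge0.
    by rewrite ss a2E; lra.
  have /andP[lo hi] := fd_sumcap_bounds W0 s0 P10 P20 (nz _ _ _ a10 e1) (nz _ _ _ a20 e2)
    (nz _ _ _ b0 e3) m0 hm.
  apply: (@le_trans _ _ K); last by rewrite lerDl.
  apply: log_affine_bound.
  + have : ln t + ln (k / 4) <= 2 * W * (ln m%:R / ln 2) * (ln 2 / W).
      rewrite (_ : 2 * W * _ * _ = ln (m%:R) *+ 2); last by rewrite mulr2n; field; rewrite !gt_eqF.
      rewrite -lnM ?posrE ?divr_gt0// -lnXn ?ltr0n//.
      rewrite ler_ln ?posrE ?mulr_gt0 ?divr_gt0 ?exprn_gt0 ?ltr0n//.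
      apply: (@le_trans _ _ ((s / 2) ^+ 2)); first by rewrite expr_div_n ss; lra.
      by apply: lerXn2r; rewrite ?nnegrE ?divr_ge0 ?sqrtr_ge0.
    by move=> /le_trans; apply; rewrite ler_pM2r// divr_gt0.
  + move: hi; rewrite -(ler_pM2r (divr_gt0 ln20 W0)) => /le_trans; apply.
    rewrite (_ : (8 + _) * (W / ln 2) * (ln 2 / W) = 8 + ln ((a1 * t + b * t + 4) * c)).
      have L0 : 0 < a1 * t + b * t + 4 by rewrite !addr_gt0 ?mulr_gt0.
      have L0' : 0 < a1 + b + 4 by rewrite !addr_gt0.
      rewrite [leRHS]addrCA lerD2l -lnM ?posrE ?mulr_gt0//.
      by rewrite ler_ln ?posrE ?mulr_gt0// mulrA ler_pM2r//; nra.
    have -> : (g2 t / g21 t) ^+ 2 = a2 / b.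
      have -> : a2 / b = (a2 * t) / (b * t) by field; rewrite !gt_eqF.
      by rewrite -e2 -e3; field; rewrite (nz _ _ _ b0 e3) !gt_eqF.
    have -> : (g1 t ^+ 2 * P1 t + g21 t ^+ 2 * P2 t + 4 * sigma t ^+ 2) / sigma t ^+ 2 =
        a1 * t + b * t + 4.
      by rewrite -e1 -e3; field; rewrite gt_eqF.
    by rewrite -[X in ln X]mulrA -cE; field; rewrite !gt_eqF.
- near=> t; apply: (@le_trans _ _ Kg); first by near: t; exact: hg.
  by rewrite lerDr addr_ge0.
Unshelve. all: by end_near.
Qed.
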